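(* The element $$\omega_4:=\sum_{k_0,\dots,k_5=1}^4\eta_{k_0k_1}\,(e_{k_1k_2}-\tfrac12\delta_{k_1k_2})\otimes(e_{k_2k_3}-\tfrac12\delta_{k_2k_3})\otimes\cdots\otimes(e_{k_5k_0}-\tfrac12\delta_{k_5k_0})\in\mathcal A(S^4_q)^{\otimes5}$$ is the representative of a $U_q(so(5))$-invariant twisted Hochschild $4$-cycle (with twist $\kappa$); that is, $h\triangleright\omega_4=\varepsilon(h)\omega_4$ for all $h\in U_q(so(5))$, $\omega_4$ is a twisted $4$-chain, and $b_\kappa\omega_4=0$.
   Context: Fix $0<q<1$; $[x]=(q^x-q^{-x})/(q-q^{-1})$. $\mathcal A(S^4_q)$ is the unital $*$-algebra generated by $x_0=x_0^*,x_1,x_1^*,x_2,x_2^*$ with relations $x_ix_j=q^2x_jx_i$ ($0\le i<j\le2$), $x_i^*x_j=q^2x_jx_i^*$ ($i\ne j$), $[x_1^*,x_1]=(1-q^4)x_0^2$, $[x_2^*,x_2]=x_1^*x_1-q^4x_1x_1^*$, $x_0^2+x_1x_1^*+x_2x_2^*=1$. $U_q(so(5))$ is the Hopf $*$-algebra generated by $K_i=K_i^*,K_i^{-1},E_i,F_i=E_i^*$ ($i=1,2$) with relations $[K_1,K_2]=0$, $K_iK_i^{-1}=K_i^{-1}K_i=1$, $[E_i,F_j]=\delta_{ij}\frac{K_j^2-K_j^{-2}}{q^j-q^{-j}}$, $K_iE_iK_i^{-1}=q^iE_i$, $K_iE_jK_i^{-1}=q^{-1}E_j$ ($i\neq j$),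 $E_1E_2^2-(q^2+q^{-2})E_2E_1E_2+E_2^2E_1=0$, $E_1^3E_2-(q^2+1+q^{-2})(E_1^2E_2E_1-E_1E_2E_1^2)-E_2E_1^3=0$, and their adjoints; $\Delta K_i=K_i\otimes K_i$, $\Delta E_i=E_i\otimes K_i+K_i^{-1}\otimes E_i$, counit $\varepsilon(K_i)=1$, $\varepsilon(E_i)=0$, $S(K_i)=K_i^{-1}$, $S(E_i)=-q^iE_i$. $\mathcal A(S^4_q)$ is a left $U_q(so(5))$-module $*$-algebra ($h\triangleright(ab)=(h_{(1)}\triangleright a)(h_{(2)}\triangleright b)$, $h\triangleright1=\varepsilon(h)1$, $h\triangleright a^*=(S(h)^*\triangleright a)^*$) with $K_1\triangleright x_1=qx_1$, $K_2\triangleright x_2=qx_2$, $K_2\triangleright x_1=q^{-1}x_1$, $K_1\triangleright x_0=x_0$, $K_2\triangleright x_0=x_0$, $K_1\triangleright x_2=x_2$; $E_1\triangleright x_0=q^{-1/2}x_1$, $E_2\triangleright x_1=x_2$, $F_1\triangleright x_1=q^{1/2}[2]x_0$, $F_1\triangleright x_0=-q^{-3/2}x_1^*$, $F_2\triangleright x_2=x_1$, and $E_i,F_i$ giving zero on $x_0,x_1,x_2$ in all other cases. On tensors $h$ acts through the iterated coproduct. Let $\kappa(a)=K_1^8K_2^6\triangleright a$ (an algebra automorphism: $\kappa(x_0)=x_0$, $\kappa(x_1)=q^2x_1$, $\kappa(x_2)=q^6x_2$), $\eta=\mathrm{diag}(q^4,q^{-2},q^2,q^{-4})$ and $$e=\frac12\begin{pmatrix}1+x_0&q^3x_2&-qx_1&0\\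 q^{-3}x_2^*&1-q^2x_0&0&q^3x_1\\ -q^{-1}x_1^*&0&1-q^2x_0&q^3x_2\\ 0&qx_1^*&q^{-3}x_2^*&1+q^4x_0\end{pmatrix}.$$ Twisted $n$-chains are the elements of $\mathcal A^{\otimes(n+1)}$ fixed by $\kappa^{\otimes(n+1)}$, and $$b_\kappa(a_0\otimes\cdots\otimes a_{n+1})=\sum_{j=0}^n(-1)^ja_0\otimes\cdots\otimes a_ja_{j+1}\otimes\cdots\otimes a_{n+1}+(-1)^{n+1}\kappa(a_{n+1})a_0\otimes a_1\otimes\cdots\otimes a_n .$$ *)

(* Defs.v *)
From HB Require Import structures.
From mathcomp Require Import all_boot all_order all_algebra.
From mathcomp Require Import boolp reals.
From mathcomp Require Import complex ring zify.

Set Implicit Arguments.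
Unset Strict Implicit.
Unset Printing Implicit Defensive.

Import Order.TTheory GRing.Theory Num.Theory.
Local Open Scope ring_scope.
Local Open Scope quotient_scope.

HB.mixin Record isStarAlgebra (C : numClosedFieldType) A
    of GRing.Algebra C A := {
  star : A -> A;
  starK : involutive star;
  starD : {morph star : x y / x + y};
  starZ : forall (c : C) (x : A), star (c *: x) = c^* *: star x;
  starM : forall x y : A, star (x * y) = star y * star x
}.

#[short(type="starAlgType")]
HB.structure Definition StarAlgebra (C : numClosedFieldType) :=
  { A of GRing.Algebra C A & isStarAlgebra C A }.

(* An augmentation is required below only to know that the tensor powers of
   the algebra are nonzero, as MathComp's algebras must be. *)
HB.mixin Record isAugmented (C : numClosedFieldType) A of StarAlgebra C A := {
  augm : A -> C;
  augmP : scalar augm;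
  augm1 : augm 1 = 1
}.

#[short(type="augStarAlgType")]
HB.structure Definition AugStarAlgebra (C : numClosedFieldType) :=
  { A of StarAlgebra C A & isAugmented C A }.

Section Base.
Variable C : numClosedFieldType.
Fact conj_starM (x y : C^o) : (x * y)^* = y^* * x^*.
Proof. by rewrite rmorphM mulrC. Qed.

HB.instance Definition _ :=
  isStarAlgebra.Build C C^o (@conjCK C) (@rmorphD _ _ (@Num.conj C)) (@rmorphM _ _ (@Num.conj C)) conj_starM.
End Base.

Section StarTheory.
Variables (C : numClosedFieldType) (A : starAlgType C).
Implicit Types x y : A.

Lemma star0 : star (0 : A) = 0.
Proof. by rewrite -(scale0r (0 : A)) starZ conjC0 !scale0r. Qed.

Lemma star1 : star (1 : A) = 1.
Proof. by rewrite -[LHS]mulr1 -[X in _ * X]starK -starM mulr1 starK. Qed.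

End StarTheory.

Section Terms.
Variables (C : numClosedFieldType) (X : Type).

Inductive term : Type :=
| TGen of X
| TZero
| TOne
| TAdd of term & term
| TScale of C & term
| TMul of term & term
| TStar of term.

HB.instance Definition _ := gen_eqMixin term.
HB.instance Definition _ := gen_choiceMixin term.

Variable rel : term -> term -> Prop.

(* The least congruence containing rel whose quotient is a *-algebra. *)
Inductive cong : term -> term -> Prop :=
| cong_rel s t : rel s t -> cong s t
| cong_refl t : cong t t
| cong_sym s t : cong s t -> cong t s
| cong_trans s t u : cong s t -> cong t u -> cong s u
| cong_add s s' t t' : cong s s' -> cong t t' -> cong (TAdd s t) (TAdd s' t')
| cong_scale c t t' : cong t t' -> cong (TScale c t) (TScale c t')
| cong_mul s s' t t' : cong s s' -> cong t t' -> cong (TMul s t) (TMul s' t')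
| cong_star t t' : cong t t' -> cong (TStar t) (TStar t')
| cong_addA s t u : cong (TAdd s (TAdd t u)) (TAdd (TAdd s t) u)
| cong_addC s t : cong (TAdd s t) (TAdd t s)
| cong_add0 t : cong (TAdd TZero t) t
| cong_addN t : cong (TAdd (TScale (-1) t) t) TZero
| cong_scaleA a b t : cong (TScale a (TScale b t)) (TScale (a * b) t)
| cong_scale1 t : cong (TScale 1 t) t
| cong_scaleDr a s t :
    cong (TScale a (TAdd s t)) (TAdd (TScale a s) (TScale a t))
| cong_scaleDl a b t :
    cong (TScale (a + b) t) (TAdd (TScale a t) (TScale b t))
| cong_mulA s t u : cong (TMul s (TMul t u)) (TMul (TMul s t) u)
| cong_mul1l t : cong (TMul TOne t) t
| cong_mul1r t : cong (TMul t TOne) t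
| cong_mulDl s t u : cong (TMul (TAdd s t) u) (TAdd (TMul s u) (TMul t u))
| cong_mulDr s t u : cong (TMul s (TAdd t u)) (TAdd (TMul s t) (TMul s u))
| cong_scaleAl a s t : cong (TScale a (TMul s t)) (TMul (TScale a s) t)
| cong_scaleAr a s t : cong (TScale a (TMul s t)) (TMul s (TScale a t))
| cong_starK t : cong (TStar (TStar t)) t
| cong_starD s t : cong (TStar (TAdd s t)) (TAdd (TStar s) (TStar t))
| cong_starZ a t : cong (TStar (TScale a t)) (TScale a^* (TStar t))
| cong_starM s t : cong (TStar (TMul s t)) (TMul (TStar t) (TStar s)).

Section Eval.
Variables (B : starAlgType C) (f : X -> B).

Fixpoint teval (t : term) : B :=
  match t with
  | TGen x => f x
  | TZero => 0
  | TOne => 1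
  | TAdd s t => teval s + teval t
  | TScale c t => c *: teval t
  | TMul s t => teval s * teval t
  | TStar t => star (teval t)
  end.

Definition satisfies := forall s t, rel s t -> teval s = teval t.

Lemma teval_cong : satisfies -> forall s t, cong s t -> teval s = teval t.
Proof.
move=> fP s t; elim=> //= {s t}.
- by move=> s t u _ -> _ ->.
- by move=> s s' t t' _ -> _ ->.
- by move=> c t t' _ ->.
- by move=> s s' t t' _ -> _ ->.
- by move=> t t' _ ->.
- by move=> *; rewrite addrA.
- by move=> *; rewrite addrC.
- by move=> *; rewrite add0r.
- by move=> *; rewrite scaleN1r addNr.
- by move=> *; rewrite scalerA.
- by move=> *; rewrite scale1r.
- by move=> *; rewrite scalerDr.
- by move=> *; rewrite scalerDl.
- by move=> *; rewrite mulrA.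
- by move=> *; rewrite mul1r.
- by move=> *; rewrite mulr1.
- by move=> *; rewrite mulrDl.
- by move=> *; rewrite mulrDr.
- by move=> *; rewrite scalerAl.
- by move=> *; rewrite scalerAr.
- by move=> *; rewrite starK.
- by move=> *; rewrite starD.
- by move=> *; rewrite starZ.
- by move=> *; rewrite starM.
Qed.

End Eval.
End Terms.

Arguments TZero {C X}.
Arguments TOne {C X}.
Arguments TGen {C X} x%_R.

Declare Scope term_scope.
Delimit Scope term_scope with T.
Bind Scope term_scope with term.
Arguments TScale {C X} c%_R t%_T.
Notation "0" := TZero : term_scope.
Notation "1" := TOne : term_scope.
Notation "s + t" := (TAdd s t) : term_scope.
Notation "c *: t" := (TScale c t) : term_scope.
Notation "s - t" := (TAdd s (TScale (-1) t)) : term_scope.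
Notation "s * t" := (TMul s t) : term_scope.
Notation "t ^*" := (TStar t) : term_scope.

Record presentation (C : numClosedFieldType) := Presentation {
  pgen : Type;
  prel : term C pgen -> term C pgen -> Prop;
  pconsistent : ~ cong prel 1%T 0%T
}.

Section Presented.
Variables (C : numClosedFieldType) (P : presentation C).
Local Notation term := (term C (pgen P)).
Local Notation cong := (cong (@prel C P)).

Definition congb (s t : term) : bool := `[< cong s t >].

Lemma congb_refl : reflexive congb.
Proof. by move=> t; apply/asboolP; apply: cong_refl. Qed.
Lemma congb_sym : symmetric congb.
Proof. by move=> s t; apply/asboolP/asboolP; apply: cong_sym. Qed.
Lemma congb_trans : transitive congb.
Proof.
by move=> t s u /asboolP st /asboolP tu; apply/asboolP; apply: cong_trans tu.
Qed.

Canonical congb_equiv := EquivRel congb congb_refl congb_sym congb_trans.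

(* The *-algebra with generators pgen P and relations prel P. *)
Definition presented := {eq_quot congb}.
HB.instance Definition _ := Choice.on presented.
HB.instance Definition _ := EqQuotient.on presented.

Implicit Types x y z : presented.

Lemma presentedP (s t : term) :
  cong s t -> \pi_presented s = \pi_presented t.
Proof. by move=> st; apply/eqmodP/asboolP. Qed.

Lemma presentedE (s t : term) :
  \pi_presented s = \pi_presented t -> cong s t.
Proof. by move/eqmodP/asboolP. Qed.

Lemma repr_cong (t : term) : cong (repr (\pi_presented t)) t.
Proof. by apply: presentedE; rewrite reprK. Qed.

Definition padd := locked (fun x y => \pi_presented (repr x + repr y)%T).
Definition pscale := locked (fun c x => \pi_presented (c *: repr x)%T).
Definition pmul := locked (fun x y => \pi_presented (repr x * repr y)%T).
Definition pstar := locked (fun x => \pi_presented ((repr x)^*)%T).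
Definition pzero := \pi_presented 0%T.
Definition pone := \pi_presented 1%T.
Definition pgenerator (i : pgen P) := \pi_presented (TGen i).

Lemma paddE s t : padd (\pi_presented s) (\pi_presented t) = \pi_presented (s + t)%T.
Proof.
by rewrite /padd -lock; apply: presentedP; apply: cong_add; apply: repr_cong.
Qed.
Lemma pscaleE c t : pscale c (\pi_presented t) = \pi_presented (c *: t)%T.
Proof.
by rewrite /pscale -lock; apply: presentedP; apply: cong_scale; apply: repr_cong.
Qed.
Lemma pmulE s t : pmul (\pi_presented s) (\pi_presented t) = \pi_presented (s * t)%T.
Proof.
by rewrite /pmul -lock; apply: presentedP; apply: cong_mul; apply: repr_cong.
Qed.
Lemma pstarE t : pstar (\pi_presented t) = \pi_presented (t^*)%T.
Proof.
by rewrite /pstar -lock; apply: presentedP; apply: cong_star; apply: repr_cong.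
Qed.

Let pE := (paddE, pscaleE, pmulE, pstarE).

Lemma paddA : associative padd.
Proof.
by elim/quotW=> s; elim/quotW=> t; elim/quotW=> u; rewrite !pE;
  apply/presentedP/cong_addA.
Qed.
Lemma paddC : commutative padd.
Proof.
by elim/quotW=> s; elim/quotW=> t; rewrite !pE; apply/presentedP/cong_addC.
Qed.
Lemma padd0 : left_id pzero padd.
Proof. by elim/quotW=> t; rewrite !pE; apply/presentedP/cong_add0. Qed.
Lemma paddN : left_inverse pzero (pscale (-1)) padd.
Proof. by elim/quotW=> t; rewrite !pE; apply/presentedP/cong_addN. Qed.

HB.instance Definition _ := GRing.isZmodule.Build presented paddA paddC padd0 paddN.

Lemma ppaddE s t :
  \pi_presented s + \pi_presented t = \pi_presented (s + t)%T.
Proof. exact: paddE. Qed.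

Lemma pscaleA a b x : pscale a (pscale b x) = pscale (a * b) x.
Proof. by elim/quotW: x=> t; rewrite !pE; apply/presentedP/cong_scaleA. Qed.
Lemma pscale1 : left_id 1 pscale.
Proof. by elim/quotW=> t; rewrite !pE; apply/presentedP/cong_scale1. Qed.
Lemma pscaleDr : right_distributive pscale +%R.
Proof.
by move=> a; elim/quotW=> s; elim/quotW=> t; rewrite !(pE, ppaddE);
  apply/presentedP/cong_scaleDr.
Qed.
Lemma pscaleDl x : {morph pscale^~ x : a b / a + b}.
Proof.
by move=> a b; elim/quotW: x=> t; rewrite !(pE, ppaddE); apply/presentedP/cong_scaleDl.
Qed.

HB.instance Definition _ :=
  GRing.Zmodule_isLmodule.Build C presented pscaleA pscale1 pscaleDr pscaleDl.

Lemma ppscaleE c t : c *: \pi_presented t = \pi_presented (c *: t)%T.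
Proof. exact: pscaleE. Qed.

Lemma pmulA : associative pmul.
Proof.
by elim/quotW=> s; elim/quotW=> t; elim/quotW=> u; rewrite !pE;
  apply/presentedP/cong_mulA.
Qed.
Lemma pmul1l : left_id pone pmul.
Proof. by elim/quotW=> t; rewrite !pE; apply/presentedP/cong_mul1l. Qed.
Lemma pmul1r : right_id pone pmul.
Proof. by elim/quotW=> t; rewrite !pE; apply/presentedP/cong_mul1r. Qed.
Lemma pmulDl : left_distributive pmul +%R.
Proof.
by elim/quotW=> s; elim/quotW=> t; elim/quotW=> u; rewrite !(pE, ppaddE, ppscaleE);
  apply/presentedP/cong_mulDl.
Qed.
Lemma pmulDr : right_distributive pmul +%R.
Proof.
by elim/quotW=> s; elim/quotW=> t; elim/quotW=> u; rewrite !(pE, ppaddE, ppscaleE);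
  apply/presentedP/cong_mulDr.
Qed.
Lemma pone_neq0 : pone != 0.
Proof. by apply/eqP=> /presentedE; apply: pconsistent. Qed.

HB.instance Definition _ := GRing.Zmodule_isNzRing.Build presented
  pmulA pmul1l pmul1r pmulDl pmulDr pone_neq0.

Lemma ppmulE s t :
  \pi_presented s * \pi_presented t = \pi_presented (s * t)%T.
Proof. exact: pmulE. Qed.

Lemma pscaleAl a x y : a *: (x * y) = a *: x * y.
Proof.
by elim/quotW: x=> s; elim/quotW: y=> t;
  rewrite !(pE, ppaddE, ppscaleE, ppmulE); apply/presentedP/cong_scaleAl.
Qed.
Lemma pscaleAr a x y : a *: (x * y) = x * (a *: y).
Proof.
by elim/quotW: x=> s; elim/quotW: y=> t;
  rewrite !(pE, ppaddE, ppscaleE, ppmulE); apply/presentedP/cong_scaleAr.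
Qed.

HB.instance Definition _ :=
  GRing.Lmodule_isLalgebra.Build C presented pscaleAl.
HB.instance Definition _ :=
  GRing.Lalgebra_isAlgebra.Build C presented pscaleAr.

Lemma pstarK : involutive pstar.
Proof. by elim/quotW=> t; rewrite !pE; apply/presentedP/cong_starK. Qed.
Lemma pstarD : {morph pstar : x y / x + y}.
Proof.
by elim/quotW=> s; elim/quotW=> t; rewrite !(pE, ppaddE, ppscaleE, ppmulE);
  apply/presentedP/cong_starD.
Qed.
Lemma pstarZ a x : pstar (a *: x) = a^* *: pstar x.
Proof.
by elim/quotW: x=> t; rewrite !(pE, ppaddE, ppscaleE, ppmulE); apply/presentedP/cong_starZ.
Qed.
Lemma pstarM x y : pstar (x * y) = pstar y * pstar x.
Proof.
by elim/quotW: x=> s; elim/quotW: y=> t; rewrite !(pE, ppaddE, ppscaleE, ppmulE);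
  apply/presentedP/cong_starM.
Qed.

HB.instance Definition _ :=
  isStarAlgebra.Build C presented pstarK pstarD pstarZ pstarM.

Lemma ppstarE t : star (\pi_presented t) = \pi_presented (t^*)%T.
Proof. exact: pstarE. Qed.

Let ppE := (ppaddE, ppscaleE, ppmulE, ppstarE).

Lemma teval_pgenerator t : teval pgenerator t = \pi_presented t.
Proof.
by elim: t => //= [s -> t ->|c t ->|s -> t ->|t ->]; rewrite ppE.
Qed.

Lemma pgenerator_satisfies : satisfies (@prel C P) pgenerator.
Proof.
by move=> s t st; rewrite !teval_pgenerator; apply/presentedP/cong_rel.
Qed.

Section Lift.
Variables (B : starAlgType C) (f : pgen P -> B).

(* The *-homomorphism with prescribed values f on the generators; meaningful
   when f satisfies the relations. *)
Definition plift (x : presented) : B := teval f (repr x).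

Hypothesis fP : satisfies (@prel C P) f.

Lemma pliftE t : plift (\pi_presented t) = teval f t.
Proof. by apply: (teval_cong fP); apply: repr_cong. Qed.

Lemma plift_gen i : plift (pgenerator i) = f i.
Proof. exact: pliftE. Qed.
Lemma plift1 : plift 1 = 1.
Proof. exact: pliftE. Qed.
Lemma plift_linear : linear plift.
Proof.
by move=> a; elim/quotW=> s; elim/quotW=> t;
  rewrite !ppE !pliftE.
Qed.
Lemma pliftM x y : plift (x * y) = plift x * plift y.
Proof.
by elim/quotW: x=> s; elim/quotW: y=> t; rewrite !ppE !pliftE.
Qed.
Lemma plift_star x : plift (star x) = star (plift x).
Proof. by elim/quotW: x=> t; rewrite !ppE !pliftE. Qed.

End Lift.
End Presented.

(* Linear identities between vectors, reduced to identities between scalars. *)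
Section LinReflect.
Variables (C : comNzRingType) (V : lmodType C).

Inductive lexp := LVar of nat | LZero | LAdd of lexp & lexp
  | LScale of C & lexp | LOpp of lexp.

Fixpoint leval (env : seq V) (e : lexp) : V :=
  match e with
  | LVar k => env`_k
  | LZero => 0
  | LAdd d e => leval env d + leval env e
  | LScale c e => c *: leval env e
  | LOpp e => - leval env e
  end.

Fixpoint lcoef (k : nat) (e : lexp) : C :=
  match e with
  | LVar j => if j == k then 1 else 0
  | LZero => 0
  | LAdd d e => lcoef k d + lcoef k e
  | LScale c e => c * lcoef k e
  | LOpp e => - lcoef k e
  end.

Lemma levalE env e :
  leval env e = \sum_(k < size env) lcoef k e *: env`_k.
Proof.
elim: e => /= [k||d -> e ->|c e ->|e ->].
- have [kn|nk] := ltnP k (size env); last first.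
    rewrite nth_default // big1 // => i _.
    by rewrite gtn_eqF ?scale0r // (leq_trans (ltn_ord i)).
  rewrite (bigD1 (Ordinal kn)) //= eqxx scale1r big1 ?addr0 // => i.
  rewrite -val_eqE /= eq_sym => /negPf ->; exact: scale0r.
- by rewrite big1 // => i _; rewrite scale0r.
- by rewrite -big_split; apply: eq_bigr => i _; rewrite scalerDl.
- by rewrite scaler_sumr; apply: eq_bigr => i _; rewrite scalerA.
- by rewrite -sumrN; apply: eq_bigr => i _; rewrite scaleNr.
Qed.

Fixpoint lzero (n : nat) (e : lexp) : Prop :=
  if n is k.+1 then lcoef k e = 0 /\ lzero k e else True.

Lemma leval_eq env d e :
  lzero (size env) (LAdd d (LOpp e)) -> leval env d = leval env e.
Proof.
move=> H; apply/eqP; rewrite -subr_eq0; apply/eqP.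
rewrite -[LHS]/(leval env (LAdd d (LOpp e))) levalE.
elim: (size env) H => [|n IH] /= => [_|[c0 H]]; first by rewrite big_ord0.
by rewrite big_ord_recr /= c0 scale0r addr0 IH.
Qed.

End LinReflect.

(* Atoms are compared up to conversion, as instances may differ. *)
Ltac lin_index x env :=
  lazymatch env with
  | ?y :: ?l =>
    match goal with
    | _ => let _ := constr:(erefl : x = y) in constr:(0%N)
    | _ => let k := lin_index x l in constr:(S k)
    end
  end.
Ltac lin_member x env :=
  lazymatch env with
  | ?y :: ?l =>
    match goal with
    | _ => let _ := constr:(erefl : x = y) in constr:(true)
    | _ => lin_member x l
    end
  | _ => constr:(false)
  end.
Ltac lin_env t env :=
  lazymatch t with
  | (?a + ?b)%R => let e := lin_env a env in lin_env b e
  | (- ?a)%R => lin_env a env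
  | (?c *: ?a)%R => lin_env a env
  | 0%R => env
  | ?x => lazymatch lin_member x env with
          | true => env | false => constr:(x :: env) end
  end.
Ltac lin_reify C t env :=
  lazymatch t with
  | (?a + ?b)%R => let x := lin_reify C a env in
      let y := lin_reify C b env in constr:(@LAdd C x y)
  | (- ?a)%R => let x := lin_reify C a env in constr:(@LOpp C x)
  | (?c *: ?a)%R => let x := lin_reify C a env in constr:(@LScale C c x)
  | 0%R => constr:(@LZero C)
  | ?x => let k := lin_index x env in constr:(@LVar C k)
  end.
Ltac lin C V :=
  lazymatch goal with
  | |- ?l = ?r =>
    let env0 := lin_env l (@nil V) in let env := lin_env r env0 in
    let d := lin_reify C l env in let e := lin_reify C r env in
    apply: (@leval_eq C V env d e); rewrite /=; repeat split
  end.

Section TensorTerms.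
Variables (C : numClosedFieldType) (V : lmodType C) (n : nat).

Definition tset (t : n.-tuple V) (i : 'I_n) (u : V) : n.-tuple V :=
  [tuple if j == i then u else tnth t j | j < n].

Inductive tterm : Type :=
| TTpure of n.-tuple V
| TTzero
| TTadd of tterm & tterm
| TTscale of C & tterm.

HB.instance Definition _ := gen_eqMixin tterm.
HB.instance Definition _ := gen_choiceMixin tterm.

(* The least congruence whose quotient is a C-vector space in which TTpure is
   multilinear. *)
Inductive tcong : tterm -> tterm -> Prop :=
| tcong_lin t i a u v :
    tcong (TTpure (tset t i (a *: u + v)))
          (TTadd (TTscale a (TTpure (tset t i u))) (TTpure (tset t i v)))
| tcong_refl s : tcong s s
| tcong_sym s t : tcong s t -> tcong t s
| tcong_trans s t u : tcong s t -> tcong t u -> tcong s u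
| tcong_add s s' t t' :
    tcong s s' -> tcong t t' -> tcong (TTadd s t) (TTadd s' t')
| tcong_scale c t t' : tcong t t' -> tcong (TTscale c t) (TTscale c t')
| tcong_addA s t u : tcong (TTadd s (TTadd t u)) (TTadd (TTadd s t) u)
| tcong_addC s t : tcong (TTadd s t) (TTadd t s)
| tcong_add0 t : tcong (TTadd TTzero t) t
| tcong_addN t : tcong (TTadd (TTscale (-1) t) t) TTzero
| tcong_scaleA a b t : tcong (TTscale a (TTscale b t)) (TTscale (a * b) t)
| tcong_scale1 t : tcong (TTscale 1 t) t
| tcong_scaleDr a s t :
    tcong (TTscale a (TTadd s t)) (TTadd (TTscale a s) (TTscale a t))
| tcong_scaleDl a b t :
    tcong (TTscale (a + b) t) (TTadd (TTscale a t) (TTscale b t)).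

Section TEval.
Variables (sg : {rmorphism C -> C}) (W : lmodType C) (f : n.-tuple V -> W).

Definition semimultilinear := forall t i a u v,
  f (tset t i (a *: u + v)) = sg a *: f (tset t i u) + f (tset t i v).

Fixpoint tteval (t : tterm) : W :=
  match t with
  | TTpure v => f v
  | TTzero => 0
  | TTadd s t => tteval s + tteval t
  | TTscale c t => sg c *: tteval t
  end.

Lemma tteval_cong :
  semimultilinear -> forall s t, tcong s t -> tteval s = tteval t.
Proof.
move=> fP s t; elim=> //= {s t}.
- by move=> s t u _ -> _ ->.
- by move=> s s' t t' _ -> _ ->.
- by move=> c t t' _ ->.
- by move=> *; rewrite addrA.
- by move=> *; rewrite addrC.
- by move=> *; rewrite add0r.
- by move=> *; rewrite rmorphN1 scaleN1r addNr.
- by move=> *; rewrite scalerA rmorphM.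
- by move=> *; rewrite rmorph1 scale1r.
- by move=> *; rewrite scalerDr.
- by move=> *; rewrite rmorphD scalerDl.
Qed.

End TEval.

Definition tcongb (s t : tterm) : bool := `[< tcong s t >].

Lemma tcongb_refl : reflexive tcongb.
Proof. by move=> t; apply/asboolP; apply: tcong_refl. Qed.
Lemma tcongb_sym : symmetric tcongb.
Proof. by move=> s t; apply/asboolP/asboolP; apply: tcong_sym. Qed.
Lemma tcongb_trans : transitive tcongb.
Proof.
by move=> t s u /asboolP st /asboolP tu; apply/asboolP; apply: tcong_trans tu.
Qed.

Canonical tcongb_equiv :=
  EquivRel tcongb tcongb_refl tcongb_sym tcongb_trans.

(* The n-th tensor power of V over C. *)
Definition tensor := {eq_quot tcongb}.
HB.instance Definition _ := Choice.on tensor.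
HB.instance Definition _ := EqQuotient.on tensor.

Implicit Types x y z : tensor.

Lemma tensorP (s t : tterm) :
  tcong s t -> \pi_tensor s = \pi_tensor t.
Proof. by move=> st; apply/eqmodP/asboolP. Qed.

Lemma trepr_cong (t : tterm) : tcong (repr (\pi_tensor t)) t.
Proof.
by apply/asboolP; have /eqmodP := reprK (\pi_tensor t).
Qed.

Definition tadd := locked (fun x y => \pi_tensor (TTadd (repr x) (repr y))).
Definition tscale := locked (fun c x => \pi_tensor (TTscale c (repr x))).
Definition tzero := \pi_tensor TTzero.

(* v_0 (x) ... (x) v_(n-1) *)
Definition tpure (v : n.-tuple V) : tensor := \pi_tensor (TTpure v).

Lemma taddE s t :
  tadd (\pi_tensor s) (\pi_tensor t) = \pi_tensor (TTadd s t).
Proof.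
by rewrite /tadd -lock; apply: tensorP; apply: tcong_add; apply: trepr_cong.
Qed.
Lemma tscaleE c t : tscale c (\pi_tensor t) = \pi_tensor (TTscale c t).
Proof.
by rewrite /tscale -lock; apply: tensorP; apply: tcong_scale; apply: trepr_cong.
Qed.

Let tE := (taddE, tscaleE).

Lemma taddA : associative tadd.
Proof.
by elim/quotW=> s; elim/quotW=> t; elim/quotW=> u; rewrite !tE;
  apply/tensorP/tcong_addA.
Qed.
Lemma taddC : commutative tadd.
Proof.
by elim/quotW=> s; elim/quotW=> t; rewrite !tE; apply/tensorP/tcong_addC.
Qed.
Lemma tadd0 : left_id tzero tadd.
Proof. by elim/quotW=> t; rewrite !tE; apply/tensorP/tcong_add0. Qed.
Lemma taddN : left_inverse tzero (tscale (-1)) tadd.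
Proof. by elim/quotW=> t; rewrite !tE; apply/tensorP/tcong_addN. Qed.

HB.instance Definition _ :=
  GRing.isZmodule.Build tensor taddA taddC tadd0 taddN.

Lemma ttaddE s t : \pi_tensor s + \pi_tensor t = \pi_tensor (TTadd s t).
Proof. exact: taddE. Qed.

Lemma tscaleA a b x : tscale a (tscale b x) = tscale (a * b) x.
Proof. by elim/quotW: x=> t; rewrite !tE; apply/tensorP/tcong_scaleA. Qed.
Lemma tscale1 : left_id 1 tscale.
Proof. by elim/quotW=> t; rewrite !tE; apply/tensorP/tcong_scale1. Qed.
Lemma tscaleDr : right_distributive tscale +%R.
Proof.
by move=> a; elim/quotW=> s; elim/quotW=> t; rewrite !(tE, ttaddE);
  apply/tensorP/tcong_scaleDr.
Qed.
Lemma tscaleDl x : {morph tscale^~ x : a b / a + b}.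
Proof.
by move=> a b; elim/quotW: x=> t; rewrite !(tE, ttaddE);
  apply/tensorP/tcong_scaleDl.
Qed.

HB.instance Definition _ :=
  GRing.Zmodule_isLmodule.Build C tensor tscaleA tscale1 tscaleDr tscaleDl.

Lemma ttscaleE c t : c *: \pi_tensor t = \pi_tensor (TTscale c t).
Proof. exact: tscaleE. Qed.

Lemma tpure_lin t i a u v :
  tpure (tset t i (a *: u + v)) = a *: tpure (tset t i u) + tpure (tset t i v).
Proof. by rewrite ttscaleE ttaddE; apply/tensorP/tcong_lin. Qed.

Lemma tensor_ind (Q : tensor -> Prop) :
  (forall v, Q (tpure v)) -> (forall c x, Q x -> Q (c *: x)) ->
  (forall x y, Q x -> Q y -> Q (x + y)) -> Q 0 -> forall x, Q x.
Proof.
move=> Qp Qs Qa Q0; elim/quotW; elim=> // [s Qs' t Qt|c t Qt].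
  by rewrite -ttaddE; apply: Qa.
by rewrite -ttscaleE; apply: Qs.
Qed.

Section TLift.
Variables (sg : {rmorphism C -> C}) (W : lmodType C) (f : n.-tuple V -> W).

(* The semilinear map sending tpure v to f v; meaningful when f is
   semimultilinear. *)
Definition stlift (x : tensor) : W := tteval sg f (repr x).

Hypothesis fP : semimultilinear sg f.

Lemma stlift_pi t : stlift (\pi_tensor t) = tteval sg f t.
Proof. by apply: (tteval_cong fP); apply: trepr_cong. Qed.

Lemma stliftE v : stlift (tpure v) = f v.
Proof. exact: stlift_pi. Qed.
Lemma stliftD : {morph stlift : x y / x + y}.
Proof.
by elim/quotW=> s; elim/quotW=> t; rewrite ttaddE !stlift_pi.
Qed.
Lemma stliftZ a x : stlift (a *: x) = sg a *: stlift x.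
Proof. by elim/quotW: x=> t; rewrite ttscaleE !stlift_pi. Qed.
Lemma stlift0 : stlift 0 = 0.
Proof. exact: stlift_pi. Qed.

End TLift.
End TensorTerms.

Arguments tpure {C V n} v.

Notation multilinear f := (semimultilinear idfun f).
Notation tlift f := (stlift idfun f).

Lemma tset_map (V W : Type) n (g : 'I_n -> V -> W) (t : n.-tuple V) i u :
  [tuple g j (tnth [tuple if k == i then u else tnth t k | k < n] j) | j < n] =
  [tuple if j == i then g i u else
     tnth [tuple g k (tnth t k) | k < n] j | j < n].
Proof.
by apply: eq_from_tnth=> j; rewrite !tnth_mktuple; case: eqP=> [->|].
Qed.

Section TensorMap.
Variables (C : numClosedFieldType) (sg : {rmorphism C -> C}).
Variables (V W : lmodType C) (n : nat) (g : 'I_n -> V -> W).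
Hypothesis gP : forall i a u v, g i (a *: u + v) = sg a *: g i u + g i v.

Lemma tpure_map_lin : semimultilinear sg
  (fun a : n.-tuple V => tpure [tuple g i (tnth a i) | i < n]).
Proof. by move=> t i a u v; rewrite /tset !tset_map gP tpure_lin. Qed.

End TensorMap.

Section TensorAlgebra.
Variables (C : numClosedFieldType) (A : augStarAlgType C) (n : nat).
Local Notation T := (tensor A n).
Implicit Types (x y z : T) (a b : n.-tuple A).

Definition tensmul x y : T :=
  tlift (fun a => tlift (fun b => tpure [tuple tnth a i * tnth b i | i < n]) y)
    x.
Definition tensone : T := tpure [tuple 1 | i < n].
Definition tensstar : T -> T :=
  stlift (@Num.conj C) (fun a => tpure [tuple star (tnth a i) | i < n]).
Definition tensaug : T -> C^o :=
  tlift (fun a => \prod_i augm (tnth a i) : C^o).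

Let mulP1 a :
  multilinear (fun b => tpure [tuple tnth a i * tnth b i | i < n]).
Proof.
apply: (tpure_map_lin (g := fun i u => tnth a i * u)) => i c u v.
by rewrite mulrDr scalerAr.
Qed.

Let mulP2 y : multilinear (fun a =>
  tlift (fun b => tpure [tuple tnth a i * tnth b i | i < n]) y).
Proof.
move=> t i c u v; elim/tensor_ind: y => [b|d y IH|x y IHx IHy|].
- rewrite !stliftE //.
  apply: (tpure_map_lin (sg := idfun) (g := fun i u => u * tnth b i)).
  by move=> j d w z; rewrite mulrDl scalerAl.
- by rewrite !stliftZ // IH /= !scalerDr !scalerA mulrC.
- by rewrite !stliftD // IHx IHy /= scalerDr addrACA.
- by rewrite !stlift0 // scaler0 addr0.
Qed.

Let starP : semimultilinear (@Num.conj C)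
  (fun a => tpure [tuple star (tnth a i) | i < n]).
Proof.
apply: (tpure_map_lin (g := fun _ u => star u)) => _ c u v.
by rewrite starD starZ.
Qed.

Let augP : multilinear (fun a : n.-tuple A => \prod_i augm (tnth a i) : C^o).
Proof.
move=> t i c u v.
have E w : \prod_j augm (tnth (tset t i w) j) =
    augm w * \prod_(j | j != i) augm (tnth t j).
  rewrite (bigD1 i) //= tnth_mktuple eqxx; congr (_ * _).
  by apply: eq_bigr=> j /negPf ji; rewrite tnth_mktuple ji.
by rewrite !E augmP mulrDl -mulrA.
Qed.

Lemma tensmul_pure a b :
  tensmul (tpure a) (tpure b) = tpure [tuple tnth a i * tnth b i | i < n].
Proof. by rewrite /tensmul !stliftE. Qed.
Lemma tensstar_pure a :
  tensstar (tpure a) = tpure [tuple star (tnth a i) | i < n].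
Proof. exact: stliftE. Qed.

Lemma tensmulDl : left_distributive tensmul +%R.
Proof. by move=> x y z; apply: stliftD. Qed.
Lemma tensmulZl c x y : c *: tensmul x y = tensmul (c *: x) y.
Proof. by rewrite /tensmul stliftZ. Qed.
Lemma tensmul0l y : tensmul 0 y = 0.
Proof. exact: stlift0. Qed.
Lemma tensmulDr : right_distributive tensmul +%R.
Proof.
elim/tensor_ind=> [a|c x IH|x y IHx IHy|] u v.
- by rewrite /tensmul !stliftE // stliftD.
- by rewrite -!tensmulZl IH scalerDr.
- by rewrite !tensmulDl IHx IHy addrACA.
- by rewrite !tensmul0l addr0.
Qed.
Lemma tensmulZr c x y : c *: tensmul x y = tensmul x (c *: y).
Proof.
elim/tensor_ind: x => [a|d x IH|x z IHx IHz|].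
- by rewrite /tensmul !stliftE // stliftZ.
- by rewrite -!tensmulZl scalerA mulrC -scalerA IH.
- by rewrite !tensmulDl scalerDr IHx IHz.
- by rewrite !tensmul0l scaler0.
Qed.
Lemma tensmul0r y : tensmul y 0 = 0.
Proof. by have := tensmulZr 0 y 0; rewrite !scale0r. Qed.

Lemma tensmulA : associative tensmul.
Proof.
elim/tensor_ind=> [a|c x IH|x x' IH IH'|] y z; last first.
- by rewrite !tensmul0l.
- by rewrite !tensmulDl IH IH'.
- by rewrite -!tensmulZl IH.
elim/tensor_ind: y=> [b|c x IH|x x' IH IH'|]; last first.
- by rewrite !(tensmul0l, tensmul0r).
- by rewrite !(tensmulDl, tensmulDr) IH IH'.
- by rewrite -!(tensmulZl, tensmulZr) IH.
elim/tensor_ind: z=> [d|c x IH|x x' IH IH'|]; last first.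
- by rewrite !tensmul0r.
- by rewrite !tensmulDr IH IH'.
- by rewrite -!tensmulZr IH.
rewrite !tensmul_pure; congr tpure; apply: eq_from_tnth=> i.
by rewrite !tnth_mktuple mulrA.
Qed.

Lemma tensmul1l : left_id tensone tensmul.
Proof.
elim/tensor_ind=> [b|c x IH|x x' IH IH'|]; last first.
- by rewrite tensmul0r.
- by rewrite tensmulDr IH IH'.
- by rewrite -tensmulZr IH.
rewrite tensmul_pure; congr tpure; apply: eq_from_tnth=> i.
by rewrite !tnth_mktuple mul1r.
Qed.
Lemma tensmul1r : right_id tensone tensmul.
Proof.
elim/tensor_ind=> [b|c x IH|x x' IH IH'|]; last first.
- by rewrite tensmul0l.
- by rewrite tensmulDl IH IH'.
- by rewrite -tensmulZl IH.
rewrite tensmul_pure; congr tpure; apply: eq_from_tnth=> i.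
by rewrite !tnth_mktuple mulr1.
Qed.

Lemma tensaug1 : tensaug tensone = 1.
Proof.
rewrite /tensaug stliftE //; apply: big1=> i _.
by rewrite tnth_mktuple augm1.
Qed.
Lemma tensone_neq0 : tensone != 0.
Proof.
apply/eqP=> /(congr1 tensaug); rewrite tensaug1 /tensaug stlift0 //.
by move/eqP; rewrite oner_eq0.
Qed.

HB.instance Definition _ := GRing.Zmodule_isNzRing.Build T
  tensmulA tensmul1l tensmul1r tensmulDl tensmulDr tensone_neq0.
HB.instance Definition _ := GRing.Lmodule_isLalgebra.Build C T tensmulZl.
HB.instance Definition _ := GRing.Lalgebra_isAlgebra.Build C T tensmulZr.

Lemma tensstarD : {morph tensstar : x y / x + y}.
Proof. exact: stliftD. Qed.
Lemma tensstarZ c x : tensstar (c *: x) = c^* *: tensstar x.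
Proof. exact: stliftZ. Qed.
Lemma tensstar0 : tensstar 0 = 0.
Proof. exact: stlift0. Qed.
Lemma tensstarK : involutive tensstar.
Proof.
elim/tensor_ind=> [b|c x IH|x x' IH IH'|]; last first.
- by rewrite !tensstar0.
- by rewrite !tensstarD IH IH'.
- by rewrite !tensstarZ IH conjCK.
rewrite !tensstar_pure; congr tpure; apply: eq_from_tnth=> i.
by rewrite !tnth_mktuple starK.
Qed.
Lemma tensstarM x y : tensstar (x * y) = tensstar y * tensstar x.
Proof.
rewrite /GRing.mul /=; elim/tensor_ind: x=> [a|c x IH|x x' IH IH'|];
  last first.
- by rewrite tensmul0l !tensstar0 tensmul0r.
- by rewrite tensmulDl !tensstarD IH IH' tensmulDr.
- by rewrite -tensmulZl !tensstarZ IH tensmulZr.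
elim/tensor_ind: y=> [b|c x IH|x x' IH IH'|]; last first.
- by rewrite tensmul0r !tensstar0 tensmul0l.
- by rewrite tensmulDr !tensstarD IH IH' tensmulDl.
- by rewrite -tensmulZr !tensstarZ IH tensmulZl.
rewrite !(tensmul_pure, tensstar_pure); congr tpure.
by apply: eq_from_tnth=> i; rewrite !tnth_mktuple starM.
Qed.

HB.instance Definition _ :=
  isStarAlgebra.Build C T tensstarK tensstarD tensstarZ tensstarM.

Lemma tpureM a b :
  tpure a * tpure b = tpure [tuple tnth a i * tnth b i | i < n] :> T.
Proof. exact: tensmul_pure. Qed.
Lemma tpure_star a :
  star (tpure a : T) = tpure [tuple star (tnth a i) | i < n].
Proof. exact: tensstar_pure. Qed.
Lemma tpure1 : tpure [tuple 1 | i < n] = 1 :> T.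
Proof. by []. Qed.

End TensorAlgebra.

Section PureTensor2.
Variables (C : numClosedFieldType) (V : lmodType C).

Lemma tpure2_linl a (u v w : V) :
  tpure [tuple a *: u + v; w] = a *: tpure [tuple u; w] + tpure [tuple v; w].
Proof.
have E z : [tuple z; w] = tset [tuple 0; w] 0 z.
  by apply: eq_from_tnth => i; rewrite tnth_mktuple; case: i => [[|[|//]]] ?.
by rewrite (E (a *: u + v)) (E u) (E v) tpure_lin.
Qed.
Lemma tpure2_linr a (u v w : V) :
  tpure [tuple w; a *: u + v] = a *: tpure [tuple w; u] + tpure [tuple w; v].
Proof.
have E z : [tuple w; z] = tset [tuple w; 0] 1 z.
  by apply: eq_from_tnth => i; rewrite tnth_mktuple; case: i => [[|[|//]]] ?.
by rewrite (E (a *: u + v)) (E u) (E v) tpure_lin.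
Qed.
Lemma tpure2Dl (u v w : V) :
  tpure [tuple u + v; w] = tpure [tuple u; w] + tpure [tuple v; w].
Proof. by rewrite -[u in LHS]scale1r tpure2_linl scale1r. Qed.
Lemma tpure2Dr (u v w : V) :
  tpure [tuple w; u + v] = tpure [tuple w; u] + tpure [tuple w; v].
Proof. by rewrite -[u in LHS]scale1r tpure2_linr scale1r. Qed.
Lemma tpure20l (w : V) : tpure [tuple 0; w] = 0.
Proof. by apply: (addIr (tpure [tuple 0; w])); rewrite -tpure2Dl !add0r. Qed.
Lemma tpure20r (w : V) : tpure [tuple w; 0] = 0.
Proof. by apply: (addIr (tpure [tuple w; 0])); rewrite -tpure2Dr !add0r. Qed.
Lemma tpure2Zl a (u w : V) :
  tpure [tuple a *: u; w] = a *: tpure [tuple u; w].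
Proof. by rewrite -[a *: u]addr0 tpure2_linl tpure20l addr0. Qed.
Lemma tpure2Zr a (u w : V) :
  tpure [tuple w; a *: u] = a *: tpure [tuple w; u].
Proof. by rewrite -[a *: u]addr0 tpure2_linr tpure20r addr0. Qed.

End PureTensor2.

Section PureTensor2Algebra.
Variables (C : numClosedFieldType) (A : augStarAlgType C).
Implicit Types a b c d : A.

Lemma tpure2M a b c d :
  tpure [tuple a; b] * tpure [tuple c; d] = tpure [tuple a * c; b * d]
    :> tensor A 2.
Proof.
rewrite tpureM; congr tpure; apply: eq_from_tnth => i.
by rewrite tnth_mktuple; case: i => [[|[|//]]] ?.
Qed.
Lemma tpure2_star a b :
  star (tpure [tuple a; b] : tensor A 2) = tpure [tuple star a; star b].
Proof.
rewrite tpure_star; congr tpure; apply: eq_from_tnth => i.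
by rewrite tnth_mktuple; case: i => [[|[|//]]] ?.
Qed.
Lemma tpure2_1 : tpure [tuple 1; 1] = 1 :> tensor A 2.
Proof.
rewrite -tpure1; congr tpure; apply: eq_from_tnth => i.
by rewrite tnth_mktuple; case: i => [[|[|//]]] ?.
Qed.

End PureTensor2Algebra.

(* The q-Serre relations are preserved by the sum of two q-commuting pairs. *)
Section QSerre.
Variables (C : numClosedFieldType) (B : algType C) (q : C).
Hypothesis q0 : q != 0.
Variables (a1 a2 b1 b2 : B).
Hypothesis ab11 : a1 * b1 = q ^+ 2 *: (b1 * a1).
Hypothesis ab12 : a1 * b2 = q ^- 2 *: (b2 * a1).
Hypothesis ab21 : a2 * b1 = q ^- 2 *: (b1 * a2).
Hypothesis ab22 : a2 * b2 = q ^+ 4 *: (b2 * a2).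

Lemma mul_swap (x a b : B) c :
  a * b = c *: (b * a) -> x * a * b = c *: (x * b * a).
Proof. by move=> e; rewrite -mulrA e -scalerAr mulrA. Qed.

Let n11 x := mul_swap x ab11.
Let n12 x := mul_swap x ab12.
Let n21 x := mul_swap x ab21.
Let n22 x := mul_swap x ab22.

Definition serre12 (x y : B) :=
  x * y * y - (q ^+ 2 + q ^- 2) *: (y * x * y) + y * y * x.
Definition serre21 (x y : B) :=
  x * x * x * y - (q ^+ 2 + 1 + q ^- 2) *: (x * x * y * x - x * y * x * x)
  - y * x * x * x.

Lemma serre12D : serre12 (a1 + b1) (a2 + b2) = serre12 a1 a2 + serre12 b1 b2.
Proof.
rewrite /serre12 !mulrDl !mulrDr !mulrDl.
rewrite !(ab11, ab12, ab21, ab22, n11, n12, n21, n22, =^~ scalerAl, scalerA).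
by lin C B; field.
Qed.

Lemma serre21D : serre21 (a1 + b1) (a2 + b2) = serre21 a1 a2 + serre21 b1 b2.
Proof.
rewrite /serre21 !mulrDl !mulrDr !mulrDl.
rewrite !(ab11, ab12, ab21, ab22, n11, n12, n21, n22, =^~ scalerAl, scalerA).
by lin C B; field.
Qed.

End QSerre.

Section Sphere.
Variables (C : numClosedFieldType) (q : C).

Inductive sphere_rel : term C 'I_3 -> term C 'I_3 -> Prop :=
| sphere_x0_self : sphere_rel ((TGen 0)^*)%T (TGen 0)
| sphere_comm (i j : 'I_3) : (i < j)%N ->
    sphere_rel (TGen i * TGen j)%T ((q ^+ 2) *: (TGen j * TGen i))%T
| sphere_star_comm (i j : 'I_3) : i != j ->
    sphere_rel ((TGen i)^* * TGen j)%T ((q ^+ 2) *: (TGen j * (TGen i)^*))%T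
| sphere_x1 :
    sphere_rel ((TGen 1)^* * TGen 1 - TGen 1 * (TGen 1)^*)%T
               ((1 - q ^+ 4) *: (TGen 0 * TGen 0))%T
| sphere_x2 :
    sphere_rel ((TGen 2)^* * TGen 2 - TGen 2 * (TGen 2)^*)%T
               ((TGen 1)^* * TGen 1 - (q ^+ 4) *: (TGen 1 * (TGen 1)^*))%T
| sphere_radius :
    sphere_rel (TGen 0 * TGen 0 + TGen 1 * (TGen 1)^* + TGen 2 * (TGen 2)^*)%T
               1%T.

Lemma sphere_consistent : ~ cong sphere_rel 1%T 0%T.
Proof.
move=> /(teval_cong (B := C^o) (f := fun i : 'I_3 => (i == 2)%:R)) /=.
suff fP : satisfies sphere_rel (B := C^o) (fun i : 'I_3 => (i == 2)%:R).
  by move/(_ fP)/eqP; rewrite oner_eq0.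
have fK (i j : 'I_3) : i != j ->
    ((i == 2)%:R * (j == 2)%:R = 0 :> C^o) /\ ((j == 2)%:R * (i == 2)%:R = 0 :> C^o).
  move=> ij; have [i2|] := eqVneq i 2; last by rewrite mul0r mulr0.
  by rewrite -i2 eq_sym (negPf ij) mul0r mulr0.
have fS (i : 'I_3) : star ((i == 2)%:R : C^o) = (i == 2)%:R.
  exact: conjC_nat.
move=> s t [|i j ij|i j ij|||] /=; rewrite ?fS.
- by rewrite star0.
- have [|-> ->] := fK i j; last by rewrite scaler0.
  by apply: contraTneq ij => ->; rewrite ltnn.
- by have [-> ->] := fK i j ij; rewrite scaler0.
- by rewrite star0 !mul0r !scaler0 addr0.
- by rewrite star0 star1 !mul0r !mulr1 !scaler0 scaleN1r subrr addr0.
- by rewrite star1 !mul0r !add0r mulr1.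
Qed.


Definition sphere_presentation := Presentation sphere_consistent.

Definition sphere4 := presented sphere_presentation.
HB.instance Definition _ := StarAlgebra.on sphere4.

Definition sphere_gen (i : 'I_3) : sphere4 :=
  pgenerator (P := sphere_presentation) i.

End Sphere.

(* Indices are shifted: GK i, GKV i, GE i stand for the generators with index
   i + 1. *)
Inductive so5_gen : Type :=
| GK of 'I_2
| GKV of 'I_2
| GE of 'I_2.

Arguments GK i%_R : rename.
Arguments GKV i%_R : rename.
Arguments GE i%_R : rename.

Section QuantumGroup.
Variables (C : numClosedFieldType) (q : C).
Local Notation TK i := (TGen (GK i)).
Local Notation TKV i := (TGen (GKV i)).
Local Notation TE i := (TGen (GE i)).
Local Notation TF i := ((TGen (GE i))^*)%T.

Inductive so5_rel : term C so5_gen -> term C so5_gen -> Prop :=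
| so5_K_self (i : 'I_2) : so5_rel ((TK i)^*)%T (TK i)
| so5_KK : so5_rel (TK 0 * TK 1)%T (TK 1 * TK 0)%T
| so5_KKV (i : 'I_2) : so5_rel (TK i * TKV i)%T 1%T
| so5_KVK (i : 'I_2) : so5_rel (TKV i * TK i)%T 1%T
| so5_EF_diag (j : 'I_2) :
    so5_rel (TE j * TF j - TF j * TE j)%T
            ((q ^+ j.+1 - q ^- j.+1)^-1 *: (TK j * TK j - TKV j * TKV j))%T
| so5_EF_off (i j : 'I_2) : i != j ->
    so5_rel (TE i * TF j - TF j * TE i)%T 0%T
| so5_KE_diag (i : 'I_2) :
    so5_rel (TK i * TE i * TKV i)%T ((q ^+ i.+1) *: TE i)%T
| so5_KE_off (i j : 'I_2) : i != j ->
    so5_rel (TK i * TE j * TKV i)%T ((q ^- 1) *: TE j)%T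
| so5_serre12 :
    so5_rel (TE 0 * TE 1 * TE 1 - (q ^+ 2 + q ^- 2) *: (TE 1 * TE 0 * TE 1)
             + TE 1 * TE 1 * TE 0)%T 0%T
| so5_serre21 :
    so5_rel (TE 0 * TE 0 * TE 0 * TE 1
             - (q ^+ 2 + 1 + q ^- 2) *:
                 (TE 0 * TE 0 * TE 1 * TE 0 - TE 0 * TE 1 * TE 0 * TE 0)
             - TE 1 * TE 0 * TE 0 * TE 0)%T 0%T.

Definition counit_gen (g : so5_gen) : C^o :=
  match g with GK _ => 1 | GKV _ => 1 | GE _ => 0 end.

Lemma counit_rel : satisfies so5_rel counit_gen.
Proof.
by move=> s t [i||i|i|j|i j _|i|i j _||] /=; rewrite ?(mulr0, mul0r, mulr1,
  scaler0, addr0, star0, star1, scaleN1r, subrr).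
Qed.

Lemma so5_consistent : ~ cong so5_rel 1%T 0%T.
Proof.
by move=> /(teval_cong counit_rel) /eqP; rewrite /= oner_eq0.
Qed.

Definition so5_presentation := Presentation so5_consistent.

Definition Uso5 := presented so5_presentation.
HB.instance Definition _ := StarAlgebra.on Uso5.

Definition Uso5_gen (g : so5_gen) : Uso5 :=
  pgenerator (P := so5_presentation) g.
Definition UK (i : 'I_2) : Uso5 := Uso5_gen (GK i).
Definition UKV (i : 'I_2) : Uso5 := Uso5_gen (GKV i).
Definition UE (i : 'I_2) : Uso5 := Uso5_gen (GE i).
Definition UF (i : 'I_2) : Uso5 := star (UE i).

Definition counit : Uso5 -> C^o := plift (P := so5_presentation) counit_gen.

Lemma counit_scalar : scalar counit.
Proof. exact: (plift_linear (P := so5_presentation) counit_rel). Qed.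
Lemma counit1 : counit 1 = 1.
Proof. exact: (plift1 (P := so5_presentation) counit_rel). Qed.

HB.instance Definition _ := isAugmented.Build C Uso5 counit_scalar counit1.

Definition coproduct_gen (g : so5_gen) : tensor Uso5 2 :=
  match g with
  | GK i => tpure [tuple UK i; UK i]
  | GKV i => tpure [tuple UKV i; UKV i]
  | GE i => tpure [tuple UE i; UK i] + tpure [tuple UKV i; UE i]
  end.

Definition coproduct : Uso5 -> tensor Uso5 2 :=
  plift (P := so5_presentation) coproduct_gen.

Local Notation K := UK.
Local Notation KV := UKV.
Local Notation E := UE.
Local Notation F := UF.

Lemma Uso5_rel : satisfies so5_rel Uso5_gen.
Proof. exact: (@pgenerator_satisfies C so5_presentation). Qed.

Lemma UK_star i : star (K i) = K i.
Proof. exact: (Uso5_rel (so5_K_self i)). Qed.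
Lemma UKK : K 0 * K 1 = K 1 * K 0.
Proof. exact: (Uso5_rel so5_KK). Qed.
Lemma UKKV i : K i * KV i = 1.
Proof. exact: (Uso5_rel (so5_KKV i)). Qed.
Lemma UKVK i : KV i * K i = 1.
Proof. exact: (Uso5_rel (so5_KVK i)). Qed.
Lemma UKV_star i : star (KV i) = KV i.
Proof.
have KS : K i * star (KV i) = 1 by rewrite -{1}(UK_star i) -starM UKVK star1.
by rewrite -[LHS]mul1r -(UKVK i) -mulrA KS mulr1.
Qed.
Lemma UEF i : E i * F i - F i * E i =
  (q ^+ i.+1 - q ^- i.+1)^-1 *: (K i * K i - KV i * KV i).
Proof.
by have := Uso5_rel (so5_EF_diag i); rewrite /= !scaleN1r.
Qed.
Lemma UEF0 i j : i != j -> E i * F j = F j * E i.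
Proof.
move=> ij; apply/eqP; rewrite -subr_eq0 -scaleN1r; apply/eqP.
exact: (Uso5_rel (so5_EF_off ij)).
Qed.
Definition cartan (i j : 'I_2) : C := if i == j then q ^+ i.+1 else q ^- 1.
Lemma UKE i j : K i * E j = cartan i j *: (E j * K i).
Proof.
rewrite scalerAl; suff <- : K i * E j * KV i = cartan i j *: E j.
  by rewrite -(mulrA _ (KV i)) UKVK mulr1.
rewrite /cartan; case: eqP => [<-|/eqP ij].
  exact: (Uso5_rel (so5_KE_diag i)).
exact: (Uso5_rel (so5_KE_off ij)).
Qed.
Lemma UEKV i j : E j * KV i = cartan i j *: (KV i * E j).
Proof.
rewrite -[LHS]mul1r -(UKVK i) -mulrA [K i * (_ * _)]mulrA UKE -scalerAl.
by rewrite -(mulrA _ (K i)) UKKV mulr1 -scalerAr.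
Qed.
Lemma UserreE12 : serre12 q (E 0) (E 1) = 0.
Proof. by have := Uso5_rel so5_serre12; rewrite /= scaleN1r. Qed.
Lemma UserreE21 : serre21 q (E 0) (E 1) = 0.
Proof. by have := Uso5_rel so5_serre21; rewrite /= !scaleN1r. Qed.

Hypothesis q0 : q != 0.

Lemma cartan_neq0 i j : cartan i j != 0.
Proof.
by rewrite /cartan; case: (i =P j) => _; rewrite ?invr_eq0 expf_neq0.
Qed.

Lemma cartan_conj : q \is Num.real -> forall i j, (cartan i j)^* = cartan i j.
Proof.
move=> qr i j; apply: conj_Creal; rewrite /cartan.
by case: eqP; rewrite ?rpredV rpredX.
Qed.

Lemma cartan_sym i j : cartan i j = cartan j i.
Proof. by rewrite /cartan eq_sym; case: eqP => // ->. Qed.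

Lemma ord2P (Q : 'I_2 -> Prop) : Q 0 -> Q 1 -> forall i, Q i.
Proof.
move=> Q0 Q1 i; have [->|->] // : i = 0 \/ i = 1.
by case: i => [[|[|//]]] ?; [left|right]; apply: val_inj.
Qed.

Lemma inv_comm (x y z : Uso5) :
  y * z = 1 -> z * y = 1 -> x * y = y * x -> x * z = z * x.
Proof.
by move=> yz zy xy; rewrite -[x in LHS]mul1r -zy -(mulrA z) -xy mulrA -mulrA yz mulr1.
Qed.

Lemma UKKC i j : K i * K j = K j * K i.
Proof. by elim/ord2P: i; elim/ord2P: j; rewrite // UKK. Qed.
Lemma UKVKC i j : K i * KV j = KV j * K i.
Proof. exact: inv_comm (UKKV j) (UKVK j) (UKKC i j). Qed.
Lemma UKVKVC i j : KV i * KV j = KV j * KV i.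
Proof. exact: inv_comm (UKKV j) (UKVK j) (esym (UKVKC j i)). Qed.

Section CoproductRelations.
Let a i : tensor Uso5 2 := tpure [tuple E i; K i].
Let b i : tensor Uso5 2 := tpure [tuple KV i; E i].

Lemma coproduct_comm i j : a i * b j = (cartan i j) ^+ 2 *: (b j * a i).
Proof.
rewrite /a /b !tpure2M UEKV UKE tpure2Zl tpure2Zr scalerA.
by rewrite (cartan_sym j i).
Qed.

Lemma UKCr x i j : x * K i * K j = x * K j * K i.
Proof. by rewrite -!mulrA UKKC. Qed.
Lemma UKVCr x i j : x * KV i * KV j = x * KV j * KV i.
Proof. by rewrite -!mulrA UKVKVC. Qed.

Lemma coproduct_serre12 : serre12 q (a 0 + b 0) (a 1 + b 1) = 0.
Proof.
rewrite serre12D // ?coproduct_comm /cartan //=.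
- transitivity (tpure [tuple serre12 q (E 0) (E 1); K 0 * K 1 * K 1]
    + tpure [tuple KV 0 * KV 1 * KV 1; serre12 q (E 0) (E 1)]).
    rewrite /serre12 /a /b !tpure2M (UKKC 1 0) (UKCr _ 1 0) (UKKC 1 0).
    rewrite (UKVKVC 1 0) (UKVCr _ 1 0) (UKVKVC 1 0) -!scaleN1r.
    rewrite !(tpure2Dl, tpure2Dr, tpure2Zl, tpure2Zr).
    by lin C (tensor Uso5 2); ring.
  by rewrite UserreE12 tpure20l tpure20r addr0.
all: by rewrite ?exprVn -?exprM.
Qed.

Lemma coproduct_serre21 : serre21 q (a 0 + b 0) (a 1 + b 1) = 0.
Proof.
rewrite serre21D // ?coproduct_comm /cartan //=.
- transitivity (tpure [tuple serre21 q (E 0) (E 1); K 0 * K 0 * K 0 * K 1]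
    + tpure [tuple KV 0 * KV 0 * KV 0 * KV 1; serre21 q (E 0) (E 1)]).
    rewrite /serre21 /a /b !tpure2M.
    rewrite !(UKKC 1 0, UKCr _ 1 0, UKVKVC 1 0, UKVCr _ 1 0) -!scaleN1r.
    rewrite !(tpure2Dl, tpure2Dr, tpure2Zl, tpure2Zr).
    by lin C (tensor Uso5 2); ring.
  by rewrite UserreE21 tpure20l tpure20r addr0.
all: by rewrite ?exprVn -?exprM.
Qed.

Section RealParameter.
Hypothesis qr : q \is Num.real.

Lemma UKF i j : F j * K i = cartan i j *: (K i * F j).
Proof.
by rewrite -{1}(UK_star i) -starM UKE starZ (cartan_conj qr) starM UK_star.
Qed.
Lemma UFKV i j : KV i * F j = cartan i j *: (F j * KV i).
Proof.
by rewrite -{1}(UKV_star i) -starM UEKV starZ (cartan_conj qr) starM UKV_star.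
Qed.

Lemma coproduct_rel : satisfies so5_rel coproduct_gen.
Proof.
have tE := (tpure2M, tpure2_star).
have eEF i j :
    (a i + b i) * star (a j + b j) - star (a j + b j) * (a i + b i) =
    tpure [tuple E i * F j - F j * E i; K j * K i]
    + tpure [tuple KV j * KV i; E i * F j - F j * E i].
  rewrite starD /a /b !tE UK_star UKV_star -!/(F j) !mulrDl !mulrDr !tE.
  rewrite (UKKC i j) (UKVKVC i j) UEKV UFKV !UKE UKF.
  rewrite -!scaleN1r !(tpure2Dl, tpure2Dr, tpure2Zl, tpure2Zr).
  rewrite (cartan_sym i j).
  by lin C (tensor Uso5 2); ring.
have eKE i j : tpure [tuple K i; K i] * (a j + b j) *
    tpure [tuple KV i; KV i] = cartan i j *: (a j + b j).
  rewrite mulrDr mulrDl /a /b !tE UKE UKKC UKVKC -!mulrA UKKV.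
  rewrite -scalerAl -mulrA UKKV !mulr1 (tpure2Zl, tpure2Zr).
  by rewrite tpure2Zr -scalerDr.
move=> s t [i||i|i|j|i j ij|i|i j ij||] /=.
- by rewrite tE !UK_star.
- by rewrite !tE UKK.
- by rewrite !tE !UKKV tpure2_1.
- by rewrite !tE !UKVK tpure2_1.
- rewrite scaleN1r eEF UEF !tE -!scaleN1r.
  rewrite !(tpure2Dl, tpure2Dr, tpure2Zl, tpure2Zr).
  by lin C (tensor Uso5 2); ring.
- by rewrite scaleN1r eEF UEF0 // subrr tpure20l tpure20r addr0.
- by rewrite eKE /cartan eqxx.
- by rewrite eKE /cartan (negPf ij).
- by rewrite scaleN1r; exact: coproduct_serre12.
- by rewrite !scaleN1r; exact: coproduct_serre21.
Qed.
End RealParameter.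
End CoproductRelations.

Definition antipode_coef (inv : bool) (i : 'I_2) : C :=
  - (if inv then q ^- i.+1 else q ^+ i.+1).

(* The antipode S (inv = false) and its inverse (inv = true), defined together
   since S (star h) = star (S^-1 h) in a Hopf *-algebra. *)
Fixpoint antipode_term (inv : bool) (t : term C so5_gen) : Uso5 :=
  match t with
  | TGen (GK i) => UKV i
  | TGen (GKV i) => UK i
  | TGen (GE i) => antipode_coef inv i *: UE i
  | TZero => 0
  | TOne => 1
  | TAdd s t => antipode_term inv s + antipode_term inv t
  | TScale c t => c *: antipode_term inv t
  | TMul s t => antipode_term inv t * antipode_term inv s
  | TStar t => star (antipode_term (~~ inv) t)
  end.

Definition antipode (h : Uso5) : Uso5 := antipode_term false (repr h).

Section AntipodeTheory.
Hypothesis qr : q \is Num.real.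

Let c := antipode_coef.

Lemma antipode_coef_conj inv i : (c inv i)^* = c inv i.
Proof.
apply: conj_Creal; rewrite /c /antipode_coef rpredN.
by case: inv; rewrite ?rpredV rpredX.
Qed.

Lemma antipode_coefM inv i : c inv i * c (~~ inv) i = 1.
Proof.
rewrite /c /antipode_coef mulrNN.
by case: inv; rewrite /= (mulVf, mulfV) ?expf_neq0.
Qed.

Lemma antipode_rel inv s t :
  so5_rel s t -> antipode_term inv s = antipode_term inv t.
Proof.
have KEKV i j : K i * E j * KV i = cartan i j *: E j.
  by rewrite UKE -scalerAl -(mulrA _ (K i)) UKKV mulr1.
have cZ i x y z : x * (c inv i *: y) * z = c inv i *: (x * y * z) :> Uso5.
  by rewrite -scalerAr -scalerAl.
have FE i j : star (c (~~ inv) j *: E j) * (c inv i *: E i)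
    = (c (~~ inv) j * c inv i) *: (F j * E i).
  by rewrite starZ antipode_coef_conj -scalerAl -scalerAr scalerA.
have EF i j : c inv i *: E i * star (c (~~ inv) j *: E j)
    = (c (~~ inv) j * c inv i) *: (E i * F j).
  by rewrite starZ antipode_coef_conj -scalerAl -scalerAr scalerA mulrC.
case=> [i||i|i|j|i j ij|i|i j ij||] /=; rewrite ?negbK ?FE ?EF.
- exact: UKV_star.
- exact: UKVKVC.
- exact: UKKV.
- exact: UKVK.
- rewrite mulrC antipode_coefM !scale1r scaleN1r -opprB UEF -scalerN.
  by rewrite scaleN1r opprB.
- by rewrite UEF0 // scaleN1r subrr.
- rewrite mulrA cZ KEKV /cartan eqxx !scalerA mulrC //.
- rewrite mulrA cZ KEKV /cartan (negPf ij) !scalerA mulrC //.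
- transitivity ((c inv 0 * c inv 1 ^+ 2) *: serre12 q (E 0) (E 1)).
    rewrite /serre12 !(=^~ scalerAl, =^~ scalerAr, mulrA).
    by lin C Uso5; ring.
  by rewrite UserreE12 scaler0.
- transitivity ((- (c inv 0 ^+ 3 * c inv 1)) *: serre21 q (E 0) (E 1)).
    rewrite /serre21 !(=^~ scalerAl, =^~ scalerAr, mulrA).
    by lin C Uso5; ring.
  by rewrite UserreE21 scaler0.
Qed.

Lemma antipode_cong inv s t :
  cong so5_rel s t -> antipode_term inv s = antipode_term inv t.
Proof.
move=> st; elim: st inv => /= {s t}.
- by move=> s t st inv; apply: antipode_rel.
- by [].
- by move=> s t _ IH inv; rewrite IH.
- by move=> s t u _ IH _ IH' inv; rewrite IH.
- by move=> s s' t t' _ IH _ IH' inv; rewrite IH IH'.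
- by move=> k t t' _ IH inv; rewrite IH.
- by move=> s s' t t' _ IH _ IH' inv; rewrite IH IH'.
- by move=> t t' _ IH inv; rewrite IH.
- by move=> *; rewrite addrA.
- by move=> *; rewrite addrC.
- by move=> *; rewrite add0r.
- by move=> *; rewrite scaleN1r addNr.
- by move=> *; rewrite scalerA.
- by move=> *; rewrite scale1r.
- by move=> *; rewrite scalerDr.
- by move=> *; rewrite scalerDl.
- by move=> *; rewrite mulrA.
- by move=> *; rewrite mulr1.
- by move=> *; rewrite mul1r.
- by move=> *; rewrite mulrDr.
- by move=> *; rewrite mulrDl.
- by move=> *; rewrite scalerAr.
- by move=> *; rewrite scalerAl.
- by move=> t inv; rewrite negbK starK.
- by move=> *; rewrite starD.
- by move=> *; rewrite starZ.
- by move=> *; rewrite starM.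
Qed.

Lemma antipodeE (t : term C so5_gen) :
  antipode (\pi_(presented so5_presentation) t) = antipode_term false t.
Proof.
by apply: antipode_cong; apply: (@repr_cong C so5_presentation).
Qed.

Lemma antipodeM g h : antipode (g * h) = antipode h * antipode g.
Proof.
by elim/quotW: g => s; elim/quotW: h => t;
  rewrite (@ppmulE C so5_presentation) !antipodeE.
Qed.
Lemma antipode_linear : linear antipode.
Proof.
move=> k; elim/quotW=> s; elim/quotW=> t.
by rewrite (@ppscaleE C so5_presentation) (@ppaddE C so5_presentation) !antipodeE.
Qed.
Lemma antipode_K i : antipode (K i) = KV i.
Proof. exact: antipodeE. Qed.
Lemma antipode_E i : antipode (E i) = - q ^+ i.+1 *: E i.
Proof. exact: antipodeE. Qed.

End AntipodeTheory.

End QuantumGroup.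

Section BilinearLift.
Variables (C : numClosedFieldType) (V V' W : lmodType C) (m n : nat).
Variable f : m.-tuple V -> n.-tuple V' -> W.

Lemma tlift_multilinear :
  (forall u, multilinear (f u)) -> (forall v, multilinear (f^~ v)) ->
  forall x, multilinear (fun u => tlift (f u) x).
Proof.
move=> f2 f1 x t i c u v; elim/tensor_ind: x => [b|d y IH|x y IHx IHy|].
- by rewrite !stliftE //; apply: f1.
- by rewrite !stliftZ // IH /= !scalerDr !scalerA mulrC.
- by rewrite !stliftD // IHx IHy /= scalerDr addrACA.
- by rewrite !stlift0 // scaler0 addr0.
Qed.

End BilinearLift.

Section TensorMaps.
Variables (C : numClosedFieldType) (V W : lmodType C) (n : nat).

Definition tensor_map (f : V -> W) : tensor V n -> tensor W n :=
  tlift (fun a : n.-tuple V => tpure [tuple f (tnth a i) | i < n]).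

Lemma tensor_map_tpure f a :
  linear f -> tensor_map f (tpure a) = tpure [tuple f (tnth a i) | i < n].
Proof.
move=> fl; rewrite /tensor_map stliftE //.
by apply: (tpure_map_lin (sg := idfun) (g := fun _ => f)).
Qed.

Lemma tpure_cons_linr (x : V) :
  multilinear (fun v : n.-tuple V => tpure [tuple of x :: v]).
Proof.
move=> t i a u v.
have E z : [tuple of x :: tset t i z] = tset [tuple of x :: t] (lift ord0 i) z.
  apply: eq_from_tnth => k; rewrite [RHS]tnth_mktuple.
  case: (unliftP ord0 k) => [j ->|->]; last by rewrite !tnth0.
  by rewrite (inj_eq lift_inj) !tnthS tnth_mktuple.
by rewrite !E tpure_lin.
Qed.

Lemma tpure_cons_linl (v : n.-tuple V) a x y :
  tpure [tuple of (a *: x + y) :: v] =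
  a *: tpure [tuple of x :: v] + tpure [tuple of y :: v].
Proof.
have E z : [tuple of z :: v] = tset [tuple of 0 :: v] ord0 z.
  apply: eq_from_tnth => k; rewrite [RHS]tnth_mktuple.
  case: (unliftP ord0 k) => [j ->|->]; last by rewrite !tnth0.
  by rewrite !tnthS.
by rewrite (E (a *: x + y)) (E x) (E y) tpure_lin.
Qed.

End TensorMaps.

Section Hochschild.
Variables (C : numClosedFieldType) (A : algType C) (kappa : A -> A) (n : nat).
Implicit Type a : n.+2.-tuple A.

Definition face (j : nat) a : n.+1.-tuple A :=
  [tuple if (i < j)%N then a`_i
         else if i == j :> nat then a`_j * a`_j.+1 else a`_i.+1 | i < n.+1].

Definition last_face a : n.+1.-tuple A :=
  [tuple if i == 0 :> nat then kappa a`_n.+1 * a`_0 else a`_i | i < n.+1].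

(* The twisted Hochschild boundary b_kappa. *)
Definition twisted_boundary : tensor A n.+2 -> tensor A n.+1 :=
  tlift (fun a => \sum_(j < n.+1) (-1) ^+ j *: tpure (face j a)
                  + (-1) ^+ n.+1 *: tpure (last_face a)).

Definition twisted_chain m (x : tensor A m.+1) : Prop :=
  tensor_map kappa x = x.

Lemma nth_tset a (k : 'I_n.+2) z i :
  (tset a k z)`_i = if i == k then z else a`_i.
Proof.
have [lt_i|ge_i] := ltnP i n.+2.
  have E (b : n.+2.-tuple A) : b`_i = tnth b (Ordinal lt_i).
    by rewrite (tnth_nth 0).
  by rewrite !E tnth_mktuple.
rewrite !nth_default ?size_tuple //.
by rewrite gtn_eqF // (leq_trans (ltn_ord k)).
Qed.

Lemma face_multilinear (j : 'I_n.+1) : multilinear (fun a => tpure (face j a)).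
Proof.
move=> t k c u v.
suff [p [g [gl E]]] : exists (p : 'I_n.+1) (g : A -> A), linear g /\
    forall z, face j (tset t k z) = tset (face j t) p (g z).
  by rewrite !E gl tpure_lin.
have ltk := ltn_ord k; have ltj := ltn_ord j.
have [lt_kj|gt_kj|eq_kj] := ltngtP k j.
- exists (Ordinal (ltn_trans lt_kj ltj)), id; split=> // z.
  apply: eq_from_tnth => i; rewrite !tnth_mktuple !nth_tset -val_eqE /=.
  by do ?case: ifP => //; lia.
- have [eq_kj1|ne_kj1] := eqVneq (k : nat) j.+1.
    exists j, (fun z => t`_j * z); split=> [d w z|z].
      by rewrite mulrDr scalerAr.
    apply: eq_from_tnth => i; rewrite !tnth_mktuple !nth_tset -val_eqE /=.
    by do ?case: ifP => //; lia.
  have ltp : (k.-1 < n.+1)%N by lia.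
  exists (Ordinal ltp), id; split=> // z.
  apply: eq_from_tnth => i; rewrite !tnth_mktuple !nth_tset -val_eqE /=.
  by do ?case: ifP => //; lia.
- exists j, (fun z => z * t`_j.+1); split=> [d w z|z].
    by rewrite mulrDl scalerAl.
  apply: eq_from_tnth => i; rewrite !tnth_mktuple !nth_tset -val_eqE /=.
  by do ?case: ifP => //; lia.
Qed.

Hypothesis kappa_linear : linear kappa.

Lemma last_face_multilinear : multilinear (fun a => tpure (last_face a)).
Proof.
move=> t k c u v.
suff [p [g [gl E]]] : exists (p : 'I_n.+1) (g : A -> A), linear g /\
    forall z, last_face (tset t k z) = tset (last_face t) p (g z).
  by rewrite !E gl tpure_lin.
have ltk := ltn_ord k.
have [lt_kn|ge_kn] := ltnP k n.+1; last first.
  exists ord0, (fun z => kappa z * t`_0); split=> [d w z|z].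
    by rewrite kappa_linear mulrDl scalerAl.
  apply: eq_from_tnth => i; rewrite !tnth_mktuple !nth_tset -val_eqE /=.
  have := ltn_ord i; by do ?case: ifP => //; lia.
have [k0|k0] := eqVneq (k : nat) 0%N.
  exists ord0, (fun z => kappa t`_n.+1 * z); split=> [d w z|z].
    by rewrite mulrDr scalerAr.
  apply: eq_from_tnth => i; rewrite !tnth_mktuple !nth_tset -val_eqE /=.
  have := ltn_ord i; by do ?case: ifP => //; lia.
exists (Ordinal lt_kn), id; split=> // z.
apply: eq_from_tnth => i; rewrite !tnth_mktuple !nth_tset -val_eqE /=.
have := ltn_ord i; by do ?case: ifP => //; lia.
Qed.

Lemma twisted_boundary_tpure a : twisted_boundary (tpure a) =
  \sum_(j < n.+1) (-1) ^+ j *: tpure (face j a)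
  + (-1) ^+ n.+1 *: tpure (last_face a).
Proof.
rewrite /twisted_boundary stliftE // => t i c u v.
rewrite last_face_multilinear.
under eq_bigr => j _ do rewrite face_multilinear scalerDr scalerA mulrC -scalerA.
rewrite big_split -scaler_sumr /= !scalerDr !scalerA [_ * c]mulrC.
by rewrite -!scalerA addrACA -scalerDr.
Qed.

End Hochschild.

Section Action.
Variables (C : numClosedFieldType) (q : C).
Local Notation U := (Uso5 q).

Fixpoint coproductn (n : nat) : U -> tensor U n.+1 :=
  match n with
  | 0 => fun h => tpure [tuple h]
  | m.+1 => fun h =>
      tlift (fun u : 2.-tuple U =>
        tlift (fun v : m.+1.-tuple U => tpure [tuple of tnth u 0 :: v])
          (coproductn m (tnth u 1)))
        (coproduct h)
  end.

Lemma coproduct_linear :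
  q != 0 -> q \is Num.real -> linear (@coproduct C q).
Proof.
move=> q0 qr.
exact: (plift_linear (P := so5_presentation q) (coproduct_rel q0 qr)).
Qed.

Lemma coproductn_step_multilinear m (f : U -> tensor U m.+1) :
  linear f ->
  multilinear (fun u : 2.-tuple U =>
    tlift (fun v : m.+1.-tuple U => tpure [tuple of tnth u 0 :: v])
      (f (tnth u 1))).
Proof.
move=> fl t i c x y; move: i; apply: ord2P; rewrite !tnth_mktuple /=.
  have := @tlift_multilinear C U U (tensor U m.+2) 1 m.+1
    (fun u v => tpure [tuple of tnth u ord0 :: v]).
  move=> /(_ _ _ (f (tnth t 1)) [tuple 0] ord0 c x y) /=.
  rewrite /tset !tnth_mktuple; apply=> [u|v].
    exact: tpure_cons_linr.
  move=> s i d z w; rewrite /tset !tnth_mktuple !ord1 /=.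
  exact: tpure_cons_linl.
have L := @tpure_cons_linr C U m.+1 (tnth t 0).
by rewrite fl stliftD // stliftZ.
Qed.

Lemma coproductn_linear n :
  q != 0 -> q \is Num.real -> linear (coproductn n).
Proof.
move=> q0 qr; elim: n => [|n IH] c g h /=.
  have E z : [tuple z] = tset [tuple 0 : U] ord0 z.
    by apply: eq_from_tnth => i; rewrite tnth_mktuple !ord1.
  by rewrite (E (c *: g + h)) (E g) (E h) tpure_lin.
have M := coproductn_step_multilinear IH.
by rewrite coproduct_linear // stliftD // stliftZ.
Qed.

Variables (A : starAlgType C) (act : U -> A -> A).

(* h acts on a tensor power through the iterated coproduct. *)
Definition tensor_act (n : nat) (h : U) (x : tensor A n.+1) : tensor A n.+1 :=
  tlift (fun u : n.+1.-tuple U =>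
    tlift (fun a : n.+1.-tuple A =>
      tpure [tuple act (tnth u i) (tnth a i) | i < n.+1]) x)
    (coproductn n h).

Record module_star_algebra : Prop := {
  act_linearl : forall a : A, linear (act^~ a);
  act_linearr : forall h : U, linear (act h);
  act_one : forall a : A, act 1 a = a;
  act_mul : forall (g h : U) (a : A), act (g * h) a = act g (act h a);
  act_prod : forall (h : U) (a b : A),
    act h (a * b) =
      tlift (fun u : 2.-tuple U => act (tnth u 0) a * act (tnth u 1) b)
        (coproduct h);
  act_unit : forall h : U, act h 1 = counit h *: 1;
  act_star : forall (h : U) (a : A),
    act h (star a) = star (act (star (antipode h)) a)
}.

Section TensorActTheory.
Hypothesis actP : module_star_algebra.

Lemma tensor_act_multilinearr n (u : n.-tuple U) :
  multilinear (fun a : n.-tuple A =>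
    tpure [tuple act (tnth u i) (tnth a i) | i < n]).
Proof.
apply: (tpure_map_lin (sg := idfun) (g := fun i => act (tnth u i))) => i c x y.
by rewrite (act_linearr actP).
Qed.

Lemma tensor_act_multilinearl n (x : tensor A n) :
  multilinear (fun u : n.-tuple U =>
    tlift (fun a : n.-tuple A =>
      tpure [tuple act (tnth u i) (tnth a i) | i < n]) x).
Proof.
apply: (tlift_multilinear (f := fun (u : n.-tuple U) (a : n.-tuple A) =>
  tpure [tuple act (tnth u i) (tnth a i) | i < n])) => [u|a].
  exact: tensor_act_multilinearr.
apply: (tpure_map_lin (sg := idfun) (g := fun i => act^~ (tnth a i))).
by move=> i c x' y; rewrite (act_linearl actP).
Qed.

End TensorActTheory.
End Action.

Section SphereAction.
Variables (C : numClosedFieldType) (q : C).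

Definition qbracket (n : nat) : C := (q ^+ n - q ^- n) / (q - q^-1).

Local Notation S4 := (sphere4 q).
Local Notation x0 := (sphere_gen q 0).
Local Notation x1 := (sphere_gen q 1).
Local Notation x2 := (sphere_gen q 2).
Local Notation K1 := (UK q 0).
Local Notation K2 := (UK q 1).
Local Notation E1 := (UE q 0).
Local Notation E2 := (UE q 1).
Local Notation F1 := (UF q 0).
Local Notation F2 := (UF q 1).

Record sphere_action (act : Uso5 q -> S4 -> S4) : Prop := {
  act_K1x0 : act K1 x0 = x0;
  act_K1x1 : act K1 x1 = q *: x1;
  act_K1x2 : act K1 x2 = x2;
  act_K2x0 : act K2 x0 = x0;
  act_K2x1 : act K2 x1 = q^-1 *: x1;
  act_K2x2 : act K2 x2 = q *: x2;
  act_E1x0 : act E1 x0 = (sqrtC q)^-1 *: x1;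
  act_E1x1 : act E1 x1 = 0;
  act_E1x2 : act E1 x2 = 0;
  act_E2x0 : act E2 x0 = 0;
  act_E2x1 : act E2 x1 = x2;
  act_E2x2 : act E2 x2 = 0;
  act_F1x0 : act F1 x0 = - (sqrtC q) ^- 3 *: star x1;
  act_F1x1 : act F1 x1 = (sqrtC q * qbracket 2) *: x0;
  act_F1x2 : act F1 x2 = 0;
  act_F2x0 : act F2 x0 = 0;
  act_F2x1 : act F2 x1 = 0;
  act_F2x2 : act F2 x2 = x1
}.

Definition twist (act : Uso5 q -> S4 -> S4) : S4 -> S4 :=
  act (K1 ^+ 8 * K2 ^+ 6).

Definition eta_mx : 'M[C]_4 :=
  diag_mx (\row_(k < 4) [:: q ^+ 4; q ^- 2; q ^+ 2; q ^- 4]`_k).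

Definition e_rows : seq (seq S4) :=
  [:: [:: 1 + x0; q ^+ 3 *: x2; - (q *: x1); 0];
      [:: q ^- 3 *: star x2; 1 - q ^+ 2 *: x0; 0; q ^+ 3 *: x1];
      [:: - (q^-1 *: star x1); 0; 1 - q ^+ 2 *: x0; q ^+ 3 *: x2];
      [:: 0; q *: star x1; q ^- 3 *: star x2; 1 + q ^+ 4 *: x0]].

Definition e_mx : 'M[S4]_4 :=
  \matrix_(i < 4, j < 4) (2^-1 *: (nth [::] e_rows i)`_j).

Definition e_shift (i j : 'I_4) : S4 := e_mx i j - (2^-1 * (i == j)%:R) *: 1.

Definition omega4 : tensor S4 5 :=
  \sum_(k0 < 4) \sum_(k1 < 4) \sum_(k2 < 4)
  \sum_(k3 < 4) \sum_(k4 < 4) \sum_(k5 < 4)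
    eta_mx k0 k1 *:
      tpure [tuple e_shift k1 k2; e_shift k2 k3; e_shift k3 k4;
                   e_shift k4 k5; e_shift k5 k0].

End SphereAction.

(* Main.v *)
Require Import Defs.
From mathcomp Require Import all_boot all_order all_algebra.
From mathcomp Require Import boolp reals complex ring.
From HB Require Import structures.

(** Put e' = e - 1/2, whose entries are multiples of the coordinates x_0, x_i,
    x_i^*.  In terms of the spinor representation, K_i acts on e' by conjugation
    with a diagonal matrix k, and a raising or lowering operator acts by
    e' |-> eps e' k^-1 - c k^-1 e' eps with k eps = c eps k.  Both formulas persist
    for the tensor powers of e', the inner terms of the iterated coproduct
    cancelling; since eta eps = c^2 eps eta, the trace against eta is killed.
    The twist acts by conjugation with eta, and e' e' = 1/4, so each of the
    five faces of the boundary of omega_4 is a quarter of the trace of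
    eta e' (x) e' (x) e' with a factor 1 inserted.  That trace vanishes, as does
    the trace of a product of three gamma matrices in dimension five. *)

Set Implicit Arguments.
Unset Strict Implicit.
Unset Printing Implicit Defensive.
Import Order.TTheory GRing.Theory Num.Theory.
Local Open Scope ring_scope.

(** * Sums over four indices, and linear maps without bundled structure *)

Lemma ord4P (Q : 'I_4 -> Prop) : Q 0 -> Q 1 -> Q 2 -> Q 3 -> forall i, Q i.
Proof.
move=> Q0 Q1 Q2 Q3 i.
have [->|[->|[->|->]]] // : i = 0 \/ i = 1 \/ i = 2 \/ i = 3.
by case: i => [[|[|[|[|//]]]]] ?; [left|right; left|do 2!right; left|do 3!right];
  apply: val_inj.
Qed.

Lemma big_ord4 (V : nmodType) (F : 'I_4 -> V) :
  \sum_(i < 4) F i = F 0 + F 1 + F 2 + F 3.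
Proof.
rewrite !big_ord_recr big_ord0 /= add0r.
by congr (F _ + F _ + F _ + F _); apply: val_inj.
Qed.

Section LinearPredicate.
Variables (C : numClosedFieldType) (V W : lmodType C) (f : V -> W).
Hypothesis fl : linear f.

(** The maps on tensor powers below are linear only under hypotheses on the action or on q, so they
    carry no canonical linear structure. Packing [f] here transfers the library's results on linear
    maps to the plain predicate. *)
Let g : {linear V -> W} := HB.pack f (GRing.isLinear.Build C _ _ _ f fl).

Lemma linpD : {morph f : x y / x + y}.
Proof. exact: (linearD g). Qed.
Lemma linpB : {morph f : x y / x - y}.
Proof. exact: (linearB g). Qed.
Lemma linpZ c : {morph f : x / c *: x}.
Proof. exact: (linearZ_LR g). Qed.
Lemma linp0 : f 0 = 0.
Proof. exact: (linear0 g). Qed.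
Lemma linp_sum I r (P : pred I) (F : I -> V) :
  f (\sum_(i <- r | P i) F i) = \sum_(i <- r | P i) f (F i).
Proof. exact: (linear_sum g). Qed.

End LinearPredicate.

Section LinearCombinators.
Variables (C : numClosedFieldType) (V W X : lmodType C).

Lemma linp_comp (f : V -> W) (g : W -> X) : linear f -> linear g -> linear (fun x => g (f x)).
Proof. by move=> fl gl c x y; rewrite fl gl. Qed.
Lemma linp_scale c (f : V -> W) : linear f -> linear (fun x => c *: f x).
Proof. by move=> fl d x y; rewrite fl scalerDr !scalerA mulrC. Qed.
Lemma linp_bigsum I (r : seq I) (F : I -> V -> W) :
  (forall i, linear (F i)) -> linear (fun x => \sum_(i <- r) F i x).
Proof.
move=> Fl c x y; rewrite scaler_sumr -big_split; apply: eq_bigr => i _; exact: Fl.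
Qed.

End LinearCombinators.

(** * Tensor powers built by prepending a factor *)

Section TensorCons.
Variables (C : numClosedFieldType) (V : lmodType C) (n : nat).

Definition tcons (a : V) (x : tensor V n) : tensor V n.+1 :=
  tlift (fun v : n.-tuple V => tpure [tuple of a :: v]) x.

Lemma tcons_tpure a (v : n.-tuple V) : tcons a (tpure v) = tpure [tuple of a :: v].
Proof. exact: (stliftE (tpure_cons_linr (n := n) a)). Qed.

Lemma tcons_linearr a : linear (tcons a).
Proof.
have P := @tpure_cons_linr _ V n a.
by move=> c x y; rewrite /tcons stliftD // stliftZ.
Qed.

Lemma tcons_linearl x : linear (tcons^~ x).
Proof.
move=> c a b /=; elim/tensor_ind: x => [v|d x IH|x y IHx IHy|].
- by rewrite !tcons_tpure tpure_cons_linl.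
- by rewrite !(linpZ (tcons_linearr _)) IH scalerDr !scalerA mulrC.
- by rewrite !(linpD (tcons_linearr _)) IHx IHy scalerDr addrACA.
- by rewrite !(linp0 (tcons_linearr _)) scaler0 addr0.
Qed.

(** This induction follows the shape in which [coproductn] and [chain] recurse: one leading factor,
    then an arbitrary tensor. *)
Lemma tensorS_ind (Q : tensor V n.+1 -> Prop) :
  (forall a x, Q (tcons a x)) -> (forall c x, Q x -> Q (c *: x)) ->
  (forall x y, Q x -> Q y -> Q (x + y)) -> Q 0 -> forall x, Q x.
Proof.
move=> Qc QZ QD Q0; apply: tensor_ind => // v.
by case/tupleP: v => a v; rewrite -tcons_tpure.
Qed.

End TensorCons.

Lemma tensor2_ind (C : numClosedFieldType) (V : lmodType C)
    (Q : tensor V 2 -> Prop) :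
  (forall a b, Q (tpure [tuple a; b])) -> (forall c x, Q x -> Q (c *: x)) ->
  (forall x y, Q x -> Q y -> Q (x + y)) -> Q 0 -> forall x, Q x.
Proof.
move=> Qp QZ QD Q0; apply: tensor_ind => // v.
suff -> : v = [tuple tnth v 0; tnth v 1] by [].
by apply: eq_from_tnth => i; case: i => [[|[|//]]] ?;
  rewrite [RHS](tnth_nth 0) /=; congr tnth; apply: val_inj.
Qed.

(** * The action through the iterated coproduct *)

Section TensorAct.
Variables (C : numClosedFieldType) (q : C).
Hypotheses (q0 : q != 0) (qr : q \is Num.real).
Variables (A : starAlgType C) (act : Uso5 q -> A -> A).
Hypothesis actP : module_star_algebra act.
Local Notation U := (Uso5 q).

Section Factorwise.
Variable n : nat.
Implicit Types (x : tensor A n) (y : tensor U n).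

(** The part of [tensor_act] that does not involve the coproduct; it is bilinear, so both arguments
    can be reduced to pure tensors. *)
Definition factorwise_act x y : tensor A n :=
  tlift (fun u : n.-tuple U => tlift (fun a : n.-tuple A =>
    tpure [tuple act (tnth u i) (tnth a i) | i < n]) x) y.

Lemma factorwise_act_linearr x : linear (factorwise_act x).
Proof.
have P := tensor_act_multilinearl actP x.
by move=> c y z; rewrite /factorwise_act stliftD // stliftZ.
Qed.

Lemma factorwise_act_tpure x u : factorwise_act x (tpure u) =
  tlift (fun a : n.-tuple A => tpure [tuple act (tnth u i) (tnth a i) | i < n]) x.
Proof. exact: (stliftE (tensor_act_multilinearl actP x)). Qed.

Lemma factorwise_act_linearl y : linear (factorwise_act^~ y).
Proof.
move=> c x1 x2 /=; elim/tensor_ind: y => [u|d y IH|y z IHy IHz|].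
- have P := tensor_act_multilinearr actP u.
  by rewrite !factorwise_act_tpure stliftD // stliftZ.
- by rewrite !(linpZ (factorwise_act_linearr _)) IH scalerDr !scalerA mulrC.
- by rewrite !(linpD (factorwise_act_linearr _)) IHy IHz scalerDr addrACA.
- by rewrite !(linp0 (factorwise_act_linearr _)) scaler0 addr0.
Qed.

End Factorwise.

Lemma factorwise_act_cons n a (x : tensor A n) h (y : tensor U n) :
  factorwise_act (tcons a x) (tcons h y) = tcons (act h a) (factorwise_act x y).
Proof.
have fl z := factorwise_act_linearr (n := z).
have fl' z := factorwise_act_linearl (n := z).
have tl := @tcons_linearr C A.
have tl' := @tcons_linearr C U.
elim/tensor_ind: y => [u|d y IH|y z IHy IHz|].
- elim/tensor_ind: x => [b|d x IH|x z IHx IHz|].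
  + rewrite !tcons_tpure !factorwise_act_tpure !stliftE; last first.
    * exact: tensor_act_multilinearr.
    * exact: tensor_act_multilinearr.
    rewrite tcons_tpure; congr tpure; apply: eq_from_tnth => i.
    rewrite tnth_mktuple; case: (unliftP ord0 i) => [j ->|->].
      by rewrite !tnthS tnth_mktuple.
    by rewrite !tnth0.
  + by rewrite (linpZ (fl' _ _)) !(linpZ (tl _ _)) (linpZ (fl' _ _)) IH.
  + by rewrite (linpD (fl' _ _)) !(linpD (tl _ _)) (linpD (fl' _ _)) IHx IHz.
  + by rewrite (linp0 (fl' _ _)) !(linp0 (tl _ _)) (linp0 (fl' _ _)).
- by rewrite (linpZ (tl' _ _)) !(linpZ (fl _ _)) (linpZ (tl _ _)) IH.
- by rewrite (linpD (tl' _ _)) !(linpD (fl _ _)) (linpD (tl _ _)) IHy IHz.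
- by rewrite (linp0 (tl' _ _)) !(linp0 (fl _ _)) (linp0 (tl _ _)).
Qed.

Section Degree2.
Variable n : nat.

Lemma tensor_act_linearr h : linear (@tensor_act C q A act n h).
Proof. exact: factorwise_act_linearl. Qed.

Lemma tensor_act_linearl x : linear (fun h => @tensor_act C q A act n h x).
Proof.
move=> c g h; rewrite /tensor_act (coproductn_linear n q0 qr).
exact: factorwise_act_linearr.
Qed.

(** Defined for every [y] in the tensor square, because a coproduct is a sum of pure tensors and not
    a pure tensor. *)
Definition cons_act a (x : tensor A n.+1) (y : tensor U 2) : tensor A n.+2 :=
  tlift (fun u : 2.-tuple U =>
    tcons (act (tnth u 0) a) (tensor_act act (tnth u 1) x)) y.

Lemma cons_act_multilinear a (x : tensor A n.+1) : multilinear (fun u : 2.-tuple U =>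
    tcons (act (tnth u 0) a) (tensor_act act (tnth u 1) x)).
Proof.
move=> t i c u v; move: i; apply: ord2P; rewrite !tnth_mktuple /=.
  by rewrite (act_linearl actP) tcons_linearl.
by rewrite (tensor_act_linearl x) tcons_linearr.
Qed.

Lemma cons_act_linear a x : linear (cons_act a x).
Proof.
have P := cons_act_multilinear a x.
by move=> c y z; rewrite /cons_act stliftD // stliftZ.
Qed.

Lemma cons_act_tpure a x g h :
  cons_act a x (tpure [tuple g; h]) = tcons (act g a) (tensor_act act h x).
Proof. by rewrite /cons_act stliftE //; apply: cons_act_multilinear. Qed.

(** [coproductn] keeps the first leg of the coproduct and iterates on the second, so the first leg
    acts on the leading factor and the second on the rest. *)
Lemma tensor_act_cons h a x :
  tensor_act act h (tcons a x) = cons_act a x (coproduct h).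
Proof.
rewrite /tensor_act -/(factorwise_act _ _) /=.
have M := coproductn_step_multilinear (coproductn_linear n q0 qr).
have fl := factorwise_act_linearr (tcons a x).
have cl := cons_act_linear a x.
elim/tensor2_ind: (coproduct h) => [g k|d y IH|y z IHy IHz|].
- by rewrite stliftE // cons_act_tpure -factorwise_act_cons.
- by rewrite stliftZ // (linpZ fl) (linpZ cl) IH.
- by rewrite stliftD // (linpD fl) (linpD cl) IHy IHz.
- by rewrite stlift0 // (linp0 fl) (linp0 cl).
Qed.

End Degree2.

Lemma tensor_act_tuple1 h a :
  tensor_act act h (tpure [tuple a]) = tpure [tuple act h a].
Proof.
rewrite /tensor_act -/(factorwise_act _ _) factorwise_act_tpure stliftE; last first.
  exact: tensor_act_multilinearr.
by congr tpure; apply: eq_from_tnth => i; rewrite tnth_mktuple !ord1.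
Qed.

Lemma coproductM (g h : U) : coproduct (g * h) = coproduct g * coproduct h.
Proof. exact: (pliftM (P := so5_presentation q) (coproduct_rel q0 qr)). Qed.

Lemma coproduct_star (h : U) : coproduct (star h) = star (coproduct h).
Proof. exact: (plift_star (P := so5_presentation q) (coproduct_rel q0 qr)). Qed.

Lemma coproduct1 : coproduct (1 : U) = tpure [tuple 1; 1].
Proof.
by rewrite tpure2_1; exact: (plift1 (P := so5_presentation q) (coproduct_rel q0 qr)).
Qed.

Lemma tensor1_ind (Q : tensor A 1 -> Prop) :
  (forall a, Q (tpure [tuple a])) -> (forall c x, Q x -> Q (c *: x)) ->
  (forall x y, Q x -> Q y -> Q (x + y)) -> Q 0 -> forall x, Q x.
Proof.
move=> Qp QZ QD Q0; apply: tensor_ind => // v.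
suff -> : v = [tuple tnth v 0] by [].
by apply: eq_from_tnth => i; rewrite !ord1.
Qed.

(** Induction on the degree. The coproduct is multiplicative and both sides are linear in the
    coproducts of [g] and of [h], so these may be taken pure; then the leading factor and the rest
    separate. *)
Lemma tensor_actM n g h (x : tensor A n.+1) :
  tensor_act act (g * h) x = tensor_act act g (tensor_act act h x).
Proof.
have tl m k := tensor_act_linearr (n := m) k.
have cl m b (z : tensor A m.+1) := cons_act_linear b z.
elim: n g h x => [|n IHn] g h.
  elim/tensor1_ind => [a|c x IH|x y IHx IHy|].
  - by rewrite !tensor_act_tuple1 (act_mul actP).
  - by rewrite !(linpZ (tl _ _)) IH.
  - by rewrite !(linpD (tl _ _)) IHx IHy.
  - by rewrite !(linp0 (tl _ _)).
elim/tensorS_ind => [a x|c x IH|x y IHx IHy|].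
- rewrite !tensor_act_cons coproductM.
  elim/tensor2_ind: (coproduct h) => [h1 h2|d y IH|y z IHy IHz|].
  + rewrite cons_act_tpure tensor_act_cons.
    elim/tensor2_ind: (coproduct g) => [g1 g2|d y IH|y z IHy IHz|].
    * by rewrite tpure2M !cons_act_tpure (act_mul actP) IHn.
    * by rewrite -scalerAl !(linpZ (cl _ _ _)) IH.
    * by rewrite mulrDl !(linpD (cl _ _ _)) IHy IHz.
    * by rewrite mul0r !(linp0 (cl _ _ _)).
  + by rewrite -scalerAr !(linpZ (cl _ _ _)) (linpZ (tl _ _)) IH.
  + by rewrite mulrDr !(linpD (cl _ _ _)) (linpD (tl _ _)) IHy IHz.
  + by rewrite mulr0 !(linp0 (cl _ _ _)) (linp0 (tl _ _)).
- by rewrite !(linpZ (tl _ _)) IH.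
- by rewrite !(linpD (tl _ _)) IHx IHy.
- by rewrite !(linp0 (tl _ _)).
Qed.

Lemma tensor_act1 n (x : tensor A n.+1) : tensor_act act 1 x = x.
Proof.
have tl m k := tensor_act_linearr (n := m) k.
elim: n x => [|n IHn].
  elim/tensor1_ind => [a|c x IH|x y IHx IHy|].
  - by rewrite !tensor_act_tuple1 (act_one actP).
  - by rewrite !(linpZ (tl _ _)) IH.
  - by rewrite !(linpD (tl _ _)) IHx IHy.
  - by rewrite !(linp0 (tl _ _)).
elim/tensorS_ind => [a x|c x IH|x y IHx IHy|].
- by rewrite tensor_act_cons coproduct1 cons_act_tpure (act_one actP) IHn.
- by rewrite !(linpZ (tl _ _)) IH.
- by rewrite !(linpD (tl _ _)) IHx IHy.
- by rewrite !(linp0 (tl _ _)).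
Qed.

(* Invariance under h does not obviously pass to star h, so both are carried
   through the induction. *)
Lemma tensor_act_invariant n (x : tensor A n.+1) :
  (forall i, tensor_act act (UK q i) x = x) ->
  (forall i, tensor_act act (UKV q i) x = x) ->
  (forall i, tensor_act act (UE q i) x = 0) ->
  (forall i, tensor_act act (UF q i) x = 0) ->
  forall h, tensor_act act h x = counit h *: x.
Proof.
move=> xK xKV xE xF.
pose inv (h : U) := tensor_act act h x = counit h *: x.
pose P := so5_presentation q.
have rP : satisfies (@prel C P) (@counit_gen C) := @counit_rel C q.
have al := tensor_act_linearl x.
have cl : linear (@counit C q) by exact: counit_scalar.
have cS (h : U) : counit (star h) = star (counit h) by exact: (plift_star rP).
have cM (g h : U) : counit (g * h) = counit g * counit h by exact: (pliftM rP).
(* Every element is the class of a term in the generators, so structural induction on terms applies;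
   for a starred term the two claims trade places. *)
suff H (t : term C (pgen P)) : inv (\pi_(presented P)%qT t) /\ inv (star (\pi_(presented P)%qT t : U)).
  by elim/quotW => t; case: (H t).
(* [UK] and [UKV] are self-adjoint and [UF] is the star of [UE], so the four hypotheses cover the
   generators and their stars. *)
have K_gen g : inv (Uso5_gen q g) /\ inv (star (Uso5_gen q g)).
  rewrite /inv cS.
  have -> : counit (Uso5_gen q g) = counit_gen C g by exact: (plift_gen rP).
  case: g => i; rewrite -?/(UK q i) -?/(UKV q i) -?/(UE q i) ?UK_star ?UKV_star;
    rewrite ?xK ?xKV ?xE ?xF /= ?star0 ?star1 ?scale1r ?scale0r //.
elim: t => [g|||s [s1 s2] t [t1 t2]|c t [t1 t2]|s [s1 s2] t [t1 t2]|t [t1 t2]].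
- exact: K_gen.
- rewrite -[X in inv X]/(0 : U) -[X in star X]/(0 : U) star0 /inv (linp0 al) (linp0 cl).
  by rewrite scale0r.
- rewrite -[X in inv X]/(1 : U) -[X in star X]/(1 : U) star1 /inv tensor_act1 counit1.
  by rewrite scale1r.
- rewrite -ppaddE starD /inv !(linpD al) !(linpD cl).
  by rewrite !scalerDl s1 s2 t1 t2.
- rewrite -ppscaleE starZ /inv !(linpZ al) !(linpZ cl).
  by rewrite -!scalerA t1 t2.
- rewrite -ppmulE starM /inv !tensor_actM !cM.
  have tl := tensor_act_linearr (n := n).
  split; first by rewrite t1 (linpZ (tl _)) s1 scalerA mulrC.
  by rewrite s2 (linpZ (tl _)) t2 scalerA mulrC.
- by rewrite -ppstarE starK.
Qed.

End TensorAct.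

(** * Tensor powers of a matrix under diagonal and skew-primitive operators *)

Section TensorMapCons.
Variables (C : numClosedFieldType) (V : lmodType C).

Lemma tcons_tuple1 (a : V) : tcons a (tpure [tuple]) = tpure [tuple a].
Proof. by rewrite tcons_tpure; congr tpure; apply: val_inj. Qed.

Lemma tensor_map_linear (W : lmodType C) n (f : V -> W) :
  linear f -> linear (tensor_map (n := n) f).
Proof.
move=> fl c x y.
have M : multilinear (fun a : n.-tuple V => tpure [tuple f (tnth a i) | i < n]).
  exact: (tpure_map_lin (sg := idfun) (g := fun _ => f)).
by rewrite /tensor_map stliftD ?stliftZ.
Qed.

Lemma tensor_map_tcons (W : lmodType C) n (f : V -> W) a (x : tensor V n) :
  linear f -> tensor_map f (tcons a x) = tcons (f a) (tensor_map f x).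
Proof.
move=> fl; have ml p := tensor_map_linear (n := p) fl.
have tl := @tcons_linearr C _ n.
elim/tensor_ind: x => [v|c x IH|x y IHx IHy|].
- rewrite tcons_tpure !tensor_map_tpure // tcons_tpure; congr tpure.
  apply: eq_from_tnth => l; rewrite tnth_mktuple.
  case: (unliftP ord0 l) => [r ->|->]; last by rewrite !tnth0.
  by rewrite !tnthS tnth_mktuple.
- by rewrite (linpZ (tl _ _)) !(linpZ (ml _)) (linpZ (tl _ _)) IH.
- by rewrite (linpD (tl _ _)) !(linpD (ml _)) (linpD (tl _ _)) IHx IHy.
- by rewrite (linp0 (tl _ _)) !(linp0 (ml _)) (linp0 (tl _ _)).
Qed.

End TensorMapCons.

Section Chain.
Variables (C : numClosedFieldType) (A : lmodType C) (m : nat) (e : 'I_m -> 'I_m -> A).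

(* The entries of the (n+1)-fold tensor power of the matrix e. *)
Fixpoint chain (n : nat) (i j : 'I_m) : tensor A n.+1 :=
  match n with
  | 0 => tcons (e i j) (tpure [tuple])
  | p.+1 => \sum_k tcons (e i k) (chain p k j)
  end.

(** Conjugation by a diagonal matrix passes to tensor powers: at each summed middle index l the
    factors k_l cancel. *)
Lemma tensor_map_chain (f : A -> A) (k : 'I_m -> C) n i j :
  linear f -> (forall i, k i != 0) ->
  (forall i j, f (e i j) = (k i / k j) *: e i j) ->
  tensor_map f (chain n i j) = (k i / k j) *: chain n i j.
Proof.
move=> fl k0 fe; elim: n i => [|n IH] i /=.
  rewrite tensor_map_tcons // fe (linpZ (tcons_linearl _)) tensor_map_tpure //.
  by congr (_ *: tcons _ (tpure _)); apply: val_inj; case: (mktuple _) => [[]].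
rewrite (linp_sum (tensor_map_linear fl)) scaler_sumr; apply: eq_bigr => l _.
rewrite tensor_map_tcons // IH fe (linpZ (tcons_linearl _)).
by rewrite (linpZ (tcons_linearr _)) scalerA mulrA divfK.
Qed.

End Chain.

Section ChainAct.
Variables (C : numClosedFieldType) (q : C).
Hypotheses (q0 : q != 0) (qr : q \is Num.real).
Variables (A : starAlgType C) (act : Uso5 q -> A -> A).
Hypothesis actP : module_star_algebra act.
Variables (m : nat) (e : 'I_m -> 'I_m -> A) (k : 'I_m -> C).
Hypothesis k0 : forall i, k i != 0.

Lemma tensor_act_tcons0 h a :
  tensor_act act h (tcons a (tpure [tuple])) = tcons (act h a) (tpure [tuple]).
Proof. by rewrite !tcons_tuple1 tensor_act_tuple1. Qed.

(** A group-like element acts on all factors at once, so the cancellation is that of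
    [tensor_map_chain]. *)
Lemma tensor_act_chain_group g n i j :
  coproduct g = tpure [tuple g; g] ->
  (forall i j, act g (e i j) = (k i / k j) *: e i j) ->
  tensor_act act g (chain e n i j) = (k i / k j) *: chain e n i j.
Proof.
move=> cg ge; elim: n i => [|n IH] i /=.
  by rewrite tensor_act_tcons0 ge (linpZ (tcons_linearl _)).
rewrite (linp_sum (tensor_act_linearr actP g)) scaler_sumr; apply: eq_bigr => l _.
rewrite tensor_act_cons // cg cons_act_tpure // IH ge (linpZ (tcons_linearl _)).
by rewrite (linpZ (tcons_linearr _)) scalerA mulrA divfK.
Qed.

(** To be used with g = K_r, g' its inverse and h = E_r or F_r. In matrix form the hypotheses say
    that g conjugates e by k, that k eps = c eps k, and that h sends e to eps e k^-1 - c k^-1 e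
    eps. *)
Variables (g g' h : Uso5 q) (c : C) (eps : 'I_m -> 'I_m -> C).
Hypotheses (cg : coproduct g = tpure [tuple g; g])
  (ch : coproduct h = tpure [tuple h; g] + tpure [tuple g'; h]).
Hypotheses (ge : forall i j, act g (e i j) = (k i / k j) *: e i j)
  (g'e : forall i j, act g' (e i j) = (k j / k i) *: e i j)
  (k_eps : forall i j, k i * eps i j = c * (eps i j * k j)).
Hypothesis he : forall i j, act h (e i j) =
  \sum_l (eps i l / k j) *: e l j - \sum_l (c * eps l j / k i) *: e i l.

(* The inner terms of the coproduct cancel pairwise. *)
Lemma tensor_act_chain_skew n i j : tensor_act act h (chain e n i j) =
  \sum_l (eps i l / k j) *: chain e n l j - \sum_l (c * eps l j / k i) *: chain e n i l.
Proof.
have tZr p a := linpZ (@tcons_linearr C A p a).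
have tZl p a := linpZ (@tcons_linearl C A p a).
elim: n i => [|n IH] i /=.
  rewrite tensor_act_tcons0 he (linpB (tcons_linearl _)) !(linp_sum (tcons_linearl _)).
  by congr (_ - _); apply: eq_bigr => l _; rewrite (tZl _ (tpure _)).
rewrite (linp_sum (tensor_act_linearr actP h)).
(* S1 - S2 comes from the term [h] tensor [g] of the coproduct, S3 - S4 from [g'] tensor [h]. In S1
   and S4 the matrix eps stands at an outer end, in S2 and S3 between the first factor and the
   rest. *)
pose S1 := \sum_p \sum_l (eps i l / k j) *: tcons (e l p) (chain e n p j).
pose S2 := \sum_p \sum_l (c * (eps l p * k p) / (k i * k j)) *: tcons (e i l) (chain e n p j).
pose S3 := \sum_p \sum_l (k p / k i * eps p l / k j) *: tcons (e i p) (chain e n l j).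
pose S4 := \sum_p \sum_l (c * eps l j / k i) *: tcons (e i p) (chain e n p l).
transitivity ((S1 - S2) + (S3 - S4)).
  rewrite /S1 /S2 /S3 /S4 -!sumrB -big_split; apply: eq_bigr => p _ /=.
  rewrite tensor_act_cons // ch (linpD (cons_act_linear q0 qr actP _ _)) !cons_act_tpure //.
  rewrite (tensor_act_chain_group _ _ _ cg ge) IH he g'e.
  rewrite !(linpB (tcons_linearl _), linp_sum (tcons_linearl _)).
  rewrite !(linpB (tcons_linearr _), linp_sum (tcons_linearr _)).
  by congr (_ - _ + (_ - _)); apply: eq_bigr => l _;
    rewrite tZl tZr scalerA; congr (_ *: _); field; rewrite !k0.
(* Once the two summation indices are exchanged, this is k eps = c eps k at the inner place. *)
have -> : S2 = S3.
  rewrite /S2 exchange_big; apply: eq_bigr => p _; apply: eq_bigr => l _.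
  by rewrite -k_eps; congr (_ *: _); field; rewrite !k0.
rewrite addrA subrK /S1 /S4 exchange_big /=; congr (_ - _).
  by apply: eq_bigr => l _; rewrite scaler_sumr.
by rewrite exchange_big; apply: eq_bigr => l _; rewrite scaler_sumr.
Qed.

Variable eta : 'I_m -> C.
Hypothesis eta_eps : forall i j, eta i * eps i j = c ^+ 2 * (eps i j * eta j).

(** The coefficient of [chain e n l i] is eps_il (eta_i / k_i - c eta_l / k_l). Where eps_il is
    nonzero, the two commutation rules give k_i = c k_l and eta_i = c^2 eta_l, and the bracket
    vanishes. *)
Lemma tensor_act_trace_skew n :
  tensor_act act h (\sum_i eta i *: chain e n i i) = 0.
Proof.
have tl := tensor_act_linearr actP (n := n) h.
rewrite (linp_sum tl).
under eq_bigr => i _ do rewrite (linpZ tl) tensor_act_chain_skew scalerBr !scaler_sumr.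
rewrite sumrB [X in _ - X]exchange_big /= -sumrB big1 // => i _.
rewrite -sumrB big1 // => l _; rewrite !scalerA -scalerBl.
have [->|nz] := eqVneq (eps i l) 0; first by rewrite !(mul0r, mulr0) subrr scale0r.
have kE : k i = c * k l by apply: (mulIf nz); rewrite k_eps mulrA mulrAC.
have c0 : c != 0 by apply: contraNneq (k0 i) => c0; rewrite kE c0 mul0r.
rewrite mulrA eta_eps kE; apply/eqP; rewrite scaler_eq0; apply/orP; left; apply/eqP.
by field; rewrite c0 k0.
Qed.

End ChainAct.

(** * The boundary in degree four and fivefold sums *)

Lemma twisted_boundary_linear (C : numClosedFieldType) (A : algType C)
  (kappa : A -> A) n : linear kappa -> linear (twisted_boundary (n := n) kappa).
Proof.
move=> kl x c y.
have M : multilinear (fun a : n.+2.-tuple A =>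
    \sum_(j < n.+1) (-1) ^+ j *: tpure (face j a)
    + (-1) ^+ n.+1 *: tpure (last_face kappa a)).
  move=> t i d u v; rewrite (last_face_multilinear kl).
  under eq_bigr => j _ do rewrite face_multilinear scalerDr scalerA mulrC -scalerA.
  rewrite big_split -scaler_sumr /= !scalerDr !scalerA [_ * d]mulrC.
  by rewrite -!scalerA addrACA -scalerDr.
by rewrite /twisted_boundary stliftD // stliftZ.
Qed.

Lemma twisted_boundary5 (C : numClosedFieldType) (A : algType C)
    (kappa : A -> A) a b c d e : linear kappa ->
  twisted_boundary kappa (tpure [tuple a; b; c; d; e]) =
    tpure [tuple a * b; c; d; e] - tpure [tuple a; b * c; d; e]
    + tpure [tuple a; b; c * d; e] - tpure [tuple a; b; c; d * e]
    + tpure [tuple kappa e * a; b; c; d].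
Proof.
move=> kl; rewrite twisted_boundary_tpure // !big_ord_recr big_ord0 /= add0r.
have sgn2 : (-1) ^+ 2 = 1 :> C by rewrite sqrrN expr1n.
have sgn3 : (-1) ^+ 3 = -1 :> C by rewrite exprS sgn2 mulr1.
have sgn4 : (-1) ^+ 4 = 1 :> C by rewrite exprS sgn3 mulrNN mulr1.
rewrite expr0 expr1 sgn2 sgn3 sgn4 !scale1r !scaleN1r.
congr (tpure _ - tpure _ + tpure _ - tpure _ + tpure _); apply: eq_from_tnth.
all: by elim/ord4P; rewrite tnth_mktuple.
Qed.

Lemma tcons_tuple4 (C : numClosedFieldType) (A : lmodType C) (a b c d : A) :
  tpure [tuple a; b; c; d] = tcons a (tcons b (tcons c (tcons d (tpure [tuple])))).
Proof. by rewrite !tcons_tpure; congr tpure; apply: val_inj. Qed.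

Local Notation sum5 F :=
  (\sum_(i < 4) \sum_(k < 4) \sum_(l < 4) \sum_(m < 4) \sum_(n < 4) F i k l m n).

Section Sum5.
Variable V : zmodType.
Implicit Types F G : 'I_4 -> 'I_4 -> 'I_4 -> 'I_4 -> 'I_4 -> V.

Lemma sum5D F G : sum5 (fun i k l m n => F i k l m n + G i k l m n) = sum5 F + sum5 G.
Proof. by do 5!(rewrite -big_split; apply: eq_bigr => ? _). Qed.

Lemma sum5B F G : sum5 (fun i k l m n => F i k l m n - G i k l m n) = sum5 F - sum5 G.
Proof. by do 5!(rewrite -sumrB; apply: eq_bigr => ? _). Qed.

(** Cyclic relabelling of the indices; it will identify the last face of the boundary with the
    first. *)
Lemma sum5_rot F : sum5 F = sum5 (fun n i k l m => F i k l m n).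
Proof. by do 4!(rewrite [RHS]exchange_big; apply: eq_bigr => ? _). Qed.

End Sum5.

(** * The generators acting on the entries of e - 1/2 *)

Section ShiftAction.
Variables (C : numClosedFieldType) (q : C).
Hypotheses (q_gt0 : 0 < q) (q_neq1 : q != 1).

Let q0 : q != 0. Proof. by rewrite gt_eqF. Qed.
Let qr : q \is Num.real. Proof. by rewrite gtr0_real. Qed.

Local Notation S4 := (sphere4 q).
Local Notation U := (Uso5 q).
Local Notation x0 := (sphere_gen q 0).
Local Notation x1 := (sphere_gen q 1).
Local Notation x2 := (sphere_gen q 2).

(* The rows of 2 e - 1. *)
Definition shift_rows : seq (seq S4) :=
  [:: [:: x0; q ^+ 3 *: x2; - (q *: x1); 0];
      [:: q ^- 3 *: star x2; - (q ^+ 2 *: x0); 0; q ^+ 3 *: x1];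
      [:: - (q^-1 *: star x1); 0; - (q ^+ 2 *: x0); q ^+ 3 *: x2];
      [:: 0; q *: star x1; q ^- 3 *: star x2; q ^+ 4 *: x0]].

(** Indices are natural numbers so that entries at concrete indices reduce by computation. *)
Definition shift (i j : nat) : S4 := 2^-1 *: (nth [::] shift_rows i)`_j.

Lemma e_shiftE (i j : 'I_4) : e_shift q i j = shift i j.
Proof.
rewrite /e_shift mxE /shift.
elim/ord4P: i; elim/ord4P: j => /=; rewrite ?mulr1 ?mulr0 ?scale0r ?subr0 //.
all: by rewrite -scalerBr addrAC subrr add0r.
Qed.

Definition eta_coef (i : nat) : C := [:: q ^+ 4; q ^- 2; q ^+ 2; q ^- 4]`_i.

(** Since [eta_mx] is diagonal, the sum over k1 keeps only the term k1 = k0. *)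
Lemma omega4_sum : omega4 q = sum5 (fun i k l m n => eta_coef i *:
  tpure [tuple shift i k; shift k l; shift l m; shift m n; shift n i]).
Proof.
rewrite /omega4; apply: eq_bigr => i _.
rewrite (bigD1 i) //= [X in _ + X]big1 ?addr0 => [|k1 k10]; last first.
  do 4!(rewrite big1 // => ? _).
  by rewrite mxE eq_sym (negPf k10) scale0r.
by do 4!(apply: eq_bigr => ? _); rewrite !mxE eqxx mulr1n !e_shiftE.
Qed.

Lemma omega4E : omega4 q =
  \sum_(i < 4) eta_coef i *: chain (fun i j : 'I_4 => shift i j) 4 i i.
Proof.
have tl p := @tcons_linearr C S4 p.
rewrite omega4_sum; apply: eq_bigr => i _ /=.
rewrite scaler_sumr; apply: eq_bigr => k _.
do 3!(rewrite !(linp_sum (tl _ _)) scaler_sumr; apply: eq_bigr => ? _).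
by congr (_ *: _); rewrite !tcons_tpure; congr tpure; apply: val_inj.
Qed.

Variable act : U -> S4 -> S4.
Hypotheses (actP : module_star_algebra act) (act_gens : sphere_action act).

Let al h := act_linearr actP h.
Let s := sqrtC q.
Let s2 : s ^+ 2 = q. Proof. exact: sqrtCK. Qed.
Let s0 : s != 0. Proof. by rewrite sqrtC_eq0. Qed.
Let sr : s^* = s.
Proof. by apply: conj_Creal; rewrite ger0_real // sqrtC_ge0 ltW. Qed.
Let qc : q^* = q.
Proof. exact: conj_Creal. Qed.

Lemma qbracket2 : qbracket q 2 = q + q^-1.
Proof.
(* The denominator q - 1/q is nonzero because q is positive and different from 1. *)
rewrite /qbracket; have : q ^+ 2 != 1.
  by rewrite -[1](expr1n _ 2) eqrXn2 // ltW.
rewrite -subr_eq0 => q2.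
by field; rewrite q0 -expr2.
Qed.

Lemma star_x0 : star x0 = x0.
Proof. exact: (pgenerator_satisfies (P := sphere_presentation q) (sphere_x0_self q)). Qed.

(** In a Hopf star-algebra S (star h) = star (S^-1 h), so the left side is S^-1 applied to [UE];
    hence the flag [true], which selects the inverse antipode. *)
Lemma star_antipode_F i :
  star (antipode (UF q i)) = antipode_coef q true i *: UE q i.
Proof.
have -> : antipode (UF q i) = antipode_term q false (TStar (TGen (GE i))).
  by rewrite -(antipodeE q0 qr) -ppstarE.
by rewrite /= starK.
Qed.

(** [sphere_action] prescribes values on x0, x1, x2 only; this and the next two lemmas supply those
    on the adjoints. *)
Lemma act_star_F i a : act (UF q i) (star a) = antipode_coef q true i *: star (act (UE q i) a).
Proof.
rewrite (act_star actP) star_antipode_F (linpZ (act_linearl actP a)) starZ.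
by rewrite (antipode_coef_conj qr).
Qed.

Lemma act_star_E i a : act (UE q i) (star a) = antipode_coef q false i *: star (act (UF q i) a).
Proof.
rewrite (act_star actP) (antipode_E q0 qr) starZ (linpZ (act_linearl actP a)) starZ.
by rewrite -/(antipode_coef q false i) !(antipode_coef_conj qr).
Qed.

Lemma act_star_K i a : act (UK q i) (star a) = star (act (UKV q i) a).
Proof. by rewrite (act_star actP) (antipode_K q0 qr) UKV_star. Qed.

Lemma act_KV i c a : c != 0 -> act (UK q i) a = c *: a -> act (UKV q i) a = c^-1 *: a.
Proof.
move=> c0 e; rewrite -{1}[a]scale1r -{1}(mulVf c0) -scalerA -e (linpZ (al _)).
by rewrite -(act_mul actP) UKVK (act_one actP).
Qed.

Lemma act_K_star i c a : c != 0 -> c^* = c -> act (UK q i) a = c *: a ->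
  act (UK q i) (star a) = c^-1 *: star a.
Proof.
by move=> c0 cr e; rewrite act_star_K (act_KV c0 e) starZ fmorphV /= cr.
Qed.

(* Diagonal matrices representing K_1 and K_2 on spinors, up to scalars. *)
Definition weight (r : 'I_2) (i : nat) : C :=
  (nth [::] [:: [:: q; q; 1; 1]; [:: 1; q^-1; q; 1]] r)`_i.

Lemma weight_neq0 r (i : 'I_4) : weight r i != 0.
Proof. by elim/ord2P: r; elim/ord4P: i; rewrite /weight /= ?oner_eq0 ?invr_eq0. Qed.

Lemma act_K_shift r (i j : 'I_4) :
  act (UK q r) (shift i j) = (weight r i / weight r j) *: shift i j.
Proof.
have [[K1x0 K1x1] K1x2] := (act_K1x0 act_gens, act_K1x1 act_gens, act_K1x2 act_gens).
have [[K2x0 K2x1] K2x2] := (act_K2x0 act_gens, act_K2x1 act_gens, act_K2x2 act_gens).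
have qVc : q^-1^* = q^-1 by rewrite fmorphV /= qc.
have K1s1 := act_K_star q0 qc K1x1.
have K1x0' : act (UK q 0) x0 = 1 *: x0 by rewrite scale1r.
have K2x0' : act (UK q 1) x0 = 1 *: x0 by rewrite scale1r.
have K1x2' : act (UK q 0) x2 = 1 *: x2 by rewrite scale1r.
have K1s2 := act_K_star (oner_neq0 C) (conjC1 C) K1x2'.
have K2s1 := act_K_star (invr_neq0 q0) qVc K2x1.
have K2s2 := act_K_star q0 qc K2x2.
rewrite /shift (linpZ (al _)) scalerA mulrC -scalerA; congr (_ *: _).
rewrite /shift_rows /weight.
elim/ord2P: r; elim/ord4P: i; elim/ord4P: j => /=;
  rewrite -?scaleN1r ?(linpZ (al _)) ?(linp0 (al _)) ?scaler0 //.
all: rewrite ?(K1x0', K1x1, K1x2', K1s1, K1s2, K2x0', K2x1, K2x2, K2s1, K2s2) ?scalerA.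
all: by congr (_ *: _); field.
Qed.

(* The matrix eps for E_(r+1); its transpose is the one for F_(r+1). *)
Definition step (r : 'I_2) (i j : nat) : C :=
  if r == 0 then ((i == j.+2) && (j < 2)%N)%:R * s else ((i == 1%N) && (j == 2))%:R.

(** This and [eta_step] are the hypotheses [k_eps] and [eta_eps] of the trace argument for raising
    operators, with c = q^-(r+1). *)
Lemma step_weight r (i j : 'I_4) :
  weight r i * step r i j = q ^- r.+1 * (step r i j * weight r j).
Proof.
by rewrite /weight /step; elim/ord2P: r; elim/ord4P: i; elim/ord4P: j => /=; field.
Qed.

Lemma eta_step r (i j : 'I_4) :
  eta_coef i * step r i j = (q ^- r.+1) ^+ 2 * (step r i j * eta_coef j).
Proof.
by rewrite /eta_coef /step; elim/ord2P: r; elim/ord4P: i; elim/ord4P: j => /=; field.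
Qed.

Lemma act_E_shift r (i j : 'I_4) : act (UE q r) (shift i j) =
  \sum_(l < 4) (step r i l / weight r j) *: shift l j
  - \sum_(l < 4) (q ^- r.+1 * step r l j / weight r i) *: shift i l.
Proof.
have [[E1x0 E1x1] E1x2] := (act_E1x0 act_gens, act_E1x1 act_gens, act_E1x2 act_gens).
have [[E2x0 E2x1] E2x2] := (act_E2x0 act_gens, act_E2x1 act_gens, act_E2x2 act_gens).
have E1s1 : act (UE q 0) (star x1) = - (q * s * (q + q^-1)) *: x0.
  rewrite act_star_E (act_F1x1 act_gens) starZ star_x0 qbracket2 scalerA.
  by rewrite rmorphM rmorphD fmorphV /= -/s sr qc /antipode_coef /= mulNr mulrA.
have E1s2 : act (UE q 0) (star x2) = 0.
  by rewrite act_star_E (act_F1x2 act_gens) star0 scaler0.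
have E2s1 : act (UE q 1) (star x1) = 0.
  by rewrite act_star_E (act_F2x1 act_gens) star0 scaler0.
have E2s2 : act (UE q 1) (star x2) = - q ^+ 2 *: star x1.
  by rewrite act_star_E (act_F2x2 act_gens).
rewrite !big_ord4 /shift (linpZ (al _)) /shift_rows /weight /step -/s.
elim/ord2P: r; elim/ord4P: i; elim/ord4P: j => /=;
  rewrite -?scaleN1r ?(linpZ (al _)) ?(linp0 (al _)) ?scaler0.
all: rewrite ?(E1x0, E1x1, E1x2, E1s1, E1s2, E2x0, E2x1, E2x2, E2s1, E2s2).
all: lin C (sphere4 q).
all: try by field.
(* The coefficients left mix q with its square root; written with q = s^2 they are rational in
   [s]. *)
all: by rewrite -[sqrtC q]/s -s2; field.
Qed.

Lemma act_F_shift r (i j : 'I_4) : act (UF q r) (shift i j) =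
  \sum_(l < 4) (step r l i / weight r j) *: shift l j
  - \sum_(l < 4) (q ^+ r.+1 * step r j l / weight r i) *: shift i l.
Proof.
have [[F1x0 F1x1] F1x2] := (act_F1x0 act_gens, act_F1x1 act_gens, act_F1x2 act_gens).
have [[F2x0 F2x1] F2x2] := (act_F2x0 act_gens, act_F2x1 act_gens, act_F2x2 act_gens).
rewrite qbracket2 in F1x1.
have F1s1 : act (UF q 0) (star x1) = 0.
  by rewrite act_star_F (act_E1x1 act_gens) star0 scaler0.
have F1s2 : act (UF q 0) (star x2) = 0.
  by rewrite act_star_F (act_E1x2 act_gens) star0 scaler0.
have F2s1 : act (UF q 1) (star x1) = - q ^- 2 *: star x2.
  by rewrite act_star_F (act_E2x1 act_gens).
have F2s2 : act (UF q 1) (star x2) = 0.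
  by rewrite act_star_F (act_E2x2 act_gens) star0 scaler0.
rewrite !big_ord4 /shift (linpZ (al _)) /shift_rows /weight /step -/s.
elim/ord2P: r; elim/ord4P: i; elim/ord4P: j => /=;
  rewrite -?scaleN1r ?(linpZ (al _)) ?(linp0 (al _)) ?scaler0.
all: rewrite ?(F1x0, F1x1, F1x2, F1s1, F1s2, F2x0, F2x1, F2x2, F2s1, F2s2).
all: lin C (sphere4 q).
all: try by field.
all: by rewrite -[sqrtC q]/s -s2; field.
Qed.

End ShiftAction.

(** * Products of entries and traces over the sphere algebra *)

Section Sphere.
Variables (C : numClosedFieldType) (q : C).
Hypotheses (q_gt0 : 0 < q) (q_neq1 : q != 1).

Let q0 : q != 0. Proof. by rewrite gt_eqF. Qed.
Let qr : q \is Num.real. Proof. by rewrite gtr0_real. Qed.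
Let qc : q^* = q. Proof. exact: conj_Creal. Qed.

Local Notation S4 := (sphere4 q).
Local Notation U := (Uso5 q).
Local Notation x0 := (sphere_gen q 0).
Local Notation x1 := (sphere_gen q 1).
Local Notation x2 := (sphere_gen q 2).
Local Notation s := (shift q).

(** Equivalent to the idempotency of e: (e - 1/2)^2 = 1/4. *)
Lemma shift_square (i j : 'I_4) :
  \sum_(k < 4) s i k * s k j = (4^-1 * (i == j)%:R) *: 1.
Proof.
have rel := @pgenerator_satisfies C (sphere_presentation q).
(* The relations become rewriting rules that order quadratic monomials as x2, x1, x0, star x1, star
   x2; the radius relation [r2] then eliminates x2 * star x2. *)
have c01 : x0 * x1 = q ^+ 2 *: (x1 * x0) by apply: (rel _ _ (sphere_comm q _)).
have c02 : x0 * x2 = q ^+ 2 *: (x2 * x0) by apply: (rel _ _ (sphere_comm q _)).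
have c12 : x1 * x2 = q ^+ 2 *: (x2 * x1) by apply: (rel _ _ (sphere_comm q _)).
have s10 : star x1 * x0 = q ^+ 2 *: (x0 * star x1) by apply: (rel _ _ (sphere_star_comm q _)).
have s20 : star x2 * x0 = q ^+ 2 *: (x0 * star x2) by apply: (rel _ _ (sphere_star_comm q _)).
have s12 : star x1 * x2 = q ^+ 2 *: (x2 * star x1) by apply: (rel _ _ (sphere_star_comm q _)).
have s21 : star x2 * x1 = q ^+ 2 *: (x1 * star x2) by apply: (rel _ _ (sphere_star_comm q _)).
have ss : star x2 * star x1 = q ^+ 2 *: (star x1 * star x2).
  by rewrite -!starM c12 starZ rmorphXn /= qc.
have x11 : star x1 * x1 = x1 * star x1 + (1 - q ^+ 4) *: (x0 * x0).
  by have := rel _ _ (sphere_x1 q); rewrite /= scaleN1r => /eqP; rewrite subr_eq addrC => /eqP.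
have r2 : x2 * star x2 = 1 - (x0 * x0 + x1 * star x1).
  by have := rel _ _ (sphere_radius q); rewrite /= => <-; rewrite addrAC subrr add0r.
have x22 : star x2 * x2 = x2 * star x2 + (star x1 * x1 - q ^+ 4 *: (x1 * star x1)).
  by have := rel _ _ (sphere_x2 q); rewrite /= !scaleN1r => /eqP; rewrite subr_eq addrC => /eqP.
rewrite big_ord4 /shift /shift_rows.
elim/ord4P: i; elim/ord4P: j => /=; rewrite -?scaleN1r.
all: rewrite -?(scalerAl, scalerAr) ?(mulr0, mul0r).
all: rewrite ?x22 ?r2 ?(c01, c02, c12, s10, s20, s12, s21, ss, x11).
all: lin C (sphere4 q).
all: by field.
Qed.

(** The cancellation takes place among the scalar coefficients: expanded by trilinearity, each value
    of [g] on three generators or adjoints gets total coefficient zero. Leaving [g] arbitrary allows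
    a factor 1 to be inserted at any position. *)
Lemma shift_trace3 (W : lmodType C) (g : S4 -> S4 -> S4 -> W) :
  (forall b c, linear (fun a => g a b c)) ->
  (forall a c, linear (fun b => g a b c)) ->
  (forall a b, linear (g a b)) ->
  \sum_(i < 4) \sum_(k < 4) \sum_(l < 4) eta_coef q i *: g (s i k) (s k l) (s l i) = 0.
Proof.
move=> g1 g2 g3.
have Z1 b d := linpZ (g1 b d); have Z2 b d := linpZ (g2 b d); have Z3 b d := linpZ (g3 b d).
have z1 b d := linp0 (g1 b d); have z2 b d := linp0 (g2 b d); have z3 b d := linp0 (g3 b d).
rewrite !big_ord4 /shift /shift_rows /eta_coef /= -!scaleN1r.
rewrite !scaler0 !(z1, z2, z3) !scaler0 !addr0 !add0r !(Z1, Z2, Z3).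
lin C W.
all: by field.
Qed.

(** Summing over the middle index leaves delta_ij / 4; the linear maps [f j] carry the remaining
    factors of a tensor. *)
Lemma shift_contract (W : lmodType C) (f : 'I_4 -> S4 -> W) (i : 'I_4) :
  (forall j, linear (f j)) ->
  \sum_(k < 4) \sum_(j < 4) f j (s i k * s k j) = 4^-1 *: f i 1.
Proof.
move=> fl; rewrite exchange_big (bigD1 i) //= [X in _ + X]big1 ?addr0.
  by rewrite -(linp_sum (fl i)) shift_square // eqxx mulr1 (linpZ (fl i)).
move=> j ji; rewrite -(linp_sum (fl j)) shift_square //.
by rewrite eq_sym (negPf ji) mulr0 scale0r (linp0 (fl j)).
Qed.

(** Variant fixing the right-hand index, for the product that ends at the index closing the
    trace. *)
Lemma shift_contractr (W : lmodType C) (f : 'I_4 -> S4 -> W) (j : 'I_4) :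
  (forall i, linear (f i)) ->
  \sum_(i < 4) \sum_(k < 4) f i (s i k * s k j) = 4^-1 *: f j 1.
Proof.
move=> fl; rewrite (bigD1 j) //= [X in _ + X]big1 ?addr0.
  by rewrite -(linp_sum (fl j)) shift_square // eqxx mulr1 (linpZ (fl j)).
move=> i ij; rewrite -(linp_sum (fl i)) shift_square //.
by rewrite (negPf ij) mulr0 scale0r (linp0 (fl i)).
Qed.

Definition tens4 (a b c d : S4) : tensor S4 4 :=
  tcons a (tcons b (tcons c (tcons d (tpure [tuple])))).

Lemma tens4_linear1 b c d : linear (fun a => tens4 a b c d).
Proof. exact: tcons_linearl. Qed.
Lemma tens4_linear2 a c d : linear (fun b => tens4 a b c d).
Proof. exact: linp_comp (tcons_linearl _) (tcons_linearr a). Qed.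
Lemma tens4_linear3 a b d : linear (fun c => tens4 a b c d).
Proof.
apply: linp_comp (tcons_linearr a); apply: linp_comp (tcons_linearr b).
exact: tcons_linearl.
Qed.
Lemma tens4_linear4 a b c : linear (tens4 a b c).
Proof.
apply: linp_comp (tcons_linearr a); apply: linp_comp (tcons_linearr b).
apply: linp_comp (tcons_linearr c); exact: tcons_linearl.
Qed.

(** Contracting the product leaves a quarter of 1 in its slot and a weighted trace of three entries
    in the others. The next three faces differ only in the slot. *)
Lemma trace_face0 : sum5 (fun i k l m n => eta_coef q i *:
  tens4 (s i k * s k l) (s l m) (s m n) (s n i)) = 0.
Proof.
transitivity (\sum_(i < 4) 4^-1 *: \sum_(m < 4) \sum_(n < 4)
    eta_coef q i *: tens4 1 (s i m) (s m n) (s n i)).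
  apply: eq_bigr => i _.
  apply: (shift_contract (f := fun l a => \sum_(m < 4) \sum_(n < 4)
    eta_coef q i *: tens4 a (s l m) (s m n) (s n i))) => l.
  by do 2!(apply: linp_bigsum => ?); apply/linp_scale/tens4_linear1.
rewrite -scaler_sumr (shift_trace3 (g := tens4 1)) ?scaler0 //.
- exact: tens4_linear2.
- exact: tens4_linear3.
- exact: tens4_linear4.
Qed.

Lemma trace_face1 : sum5 (fun i k l m n => eta_coef q i *:
  tens4 (s i k) (s k l * s l m) (s m n) (s n i)) = 0.
Proof.
transitivity (\sum_(i < 4) \sum_(k < 4) 4^-1 *: \sum_(n < 4)
    eta_coef q i *: tens4 (s i k) 1 (s k n) (s n i)).
  apply: eq_bigr => i _; apply: eq_bigr => k _.
  apply: (shift_contract (f := fun m a => \sum_(n < 4)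
    eta_coef q i *: tens4 (s i k) a (s m n) (s n i))) => m.
  by apply: linp_bigsum => ?; apply/linp_scale/tens4_linear2.
under eq_bigr => i _ do rewrite -scaler_sumr.
rewrite -scaler_sumr (shift_trace3 (g := fun a => tens4 a 1)) ?scaler0 // => *.
- exact: tens4_linear1.
- exact: tens4_linear3.
- exact: tens4_linear4.
Qed.

Lemma trace_face2 : sum5 (fun i k l m n => eta_coef q i *:
  tens4 (s i k) (s k l) (s l m * s m n) (s n i)) = 0.
Proof.
transitivity (\sum_(i < 4) \sum_(k < 4) \sum_(l < 4) 4^-1 *:
    (eta_coef q i *: tens4 (s i k) (s k l) 1 (s l i))).
  apply: eq_bigr => i _; apply: eq_bigr => k _; apply: eq_bigr => l _.
  apply: (shift_contract (f := fun n a =>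
    eta_coef q i *: tens4 (s i k) (s k l) a (s n i))) => n.
  by apply/linp_scale/tens4_linear3.
under eq_bigr => i _ do (under eq_bigr => k _ do rewrite -scaler_sumr; rewrite -scaler_sumr).
rewrite -scaler_sumr (shift_trace3 (g := fun a b => tens4 a b 1)) ?scaler0 // => *.
- exact: tens4_linear1.
- exact: tens4_linear2.
- exact: tens4_linear4.
Qed.

Lemma trace_face3 : sum5 (fun i k l m n => eta_coef q i *:
  tens4 (s i k) (s k l) (s l m) (s m n * s n i)) = 0.
Proof.
transitivity (\sum_(i < 4) \sum_(k < 4) \sum_(l < 4) 4^-1 *:
    (eta_coef q i *: tens4 (s i k) (s k l) (s l i) 1)).
  apply: eq_bigr => i _; apply: eq_bigr => k _; apply: eq_bigr => l _.
  apply: (shift_contractr (f := fun m a =>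
    eta_coef q i *: tens4 (s i k) (s k l) (s l m) a)) => m.
  by apply/linp_scale/tens4_linear4.
under eq_bigr => i _ do (under eq_bigr => k _ do rewrite -scaler_sumr; rewrite -scaler_sumr).
rewrite -scaler_sumr (shift_trace3 (g := fun a b c => tens4 a b c 1)) ?scaler0 // => *.
- exact: tens4_linear1.
- exact: tens4_linear2.
- exact: tens4_linear3.
Qed.

(** * The twist, the cycle condition and invariance *)

Variable act : U -> S4 -> S4.
Hypotheses (actP : module_star_algebra act) (act_gens : sphere_action act).

Let al h := act_linearr actP h.

Lemma eta_neq0 (i : 'I_4) : eta_coef q i != 0.
Proof. by elim/ord4P: i; rewrite /eta_coef /= ?invr_eq0 expf_neq0. Qed.

Lemma act_KX_shift r n (i j : 'I_4) :
  act (UK q r ^+ n) (s i j) = (weight q r i / weight q r j) ^+ n *: s i j.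
Proof.
elim: n => [|n IH]; first by rewrite !expr0 (act_one actP) scale1r.
rewrite exprS (act_mul actP) IH (linpZ (al _)) act_K_shift // scalerA.
by rewrite -exprSr.
Qed.

(** With k_1, k_2 the diagonal matrices [weight], k_1^8 k_2^6 = diag(q^8, q^2, q^6, 1) = q^4 eta,
    and the scalar q^4 drops out of the conjugation. *)
Lemma twist_shift (i j : 'I_4) :
  twist act (s i j) = (eta_coef q i / eta_coef q j) *: s i j.
Proof.
rewrite /twist (act_mul actP) act_KX_shift (linpZ (al _)) act_KX_shift scalerA.
congr (_ *: _); rewrite /weight /eta_coef.
by elim/ord4P: i; elim/ord4P: j => /=; field.
Qed.

Lemma omega4_boundary : twisted_boundary (twist act) (omega4 q) = 0.
Proof.
have kl : linear (twist act) by exact: al.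
have bl := twisted_boundary_linear (n := 3) kl.
have bE (i k l m n : 'I_4) (t := [tuple s i k; s k l; s l m; s m n; s n i]) :
  twisted_boundary (twist act) (eta_coef q i *: tpure t) =
    eta_coef q i *: tens4 (s i k * s k l) (s l m) (s m n) (s n i)
    - eta_coef q i *: tens4 (s i k) (s k l * s l m) (s m n) (s n i)
    + eta_coef q i *: tens4 (s i k) (s k l) (s l m * s m n) (s n i)
    - eta_coef q i *: tens4 (s i k) (s k l) (s l m) (s m n * s n i)
    + eta_coef q n *: tens4 (s n i * s i k) (s k l) (s l m) (s m n).
  (* The twist multiplies [s n i] by eta_n / eta_i, which moves the weight to the index n where the
     trace of the last face begins. *)
  have lastE : eta_coef q i *: tens4 (twist act (s n i) * s i k) (s k l) (s l m) (s m n) =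
      eta_coef q n *: tens4 (s n i * s i k) (s k l) (s l m) (s m n).
    have tZ c x : tens4 (c *: x) (s k l) (s l m) (s m n) = c *: tens4 x (s k l) (s l m) (s m n).
      exact: linpZ (tens4_linear1 _ _ _) c x.
    rewrite twist_shift -scalerAl tZ scalerA mulrC divfK //; exact: eta_neq0.
  rewrite -lastE (linpZ bl) twisted_boundary5 // !tcons_tuple4.
  by rewrite !scalerDr !scalerN.
rewrite omega4_sum.
transitivity (sum5 (fun i k l m n =>
    eta_coef q i *: tens4 (s i k * s k l) (s l m) (s m n) (s n i)
    - eta_coef q i *: tens4 (s i k) (s k l * s l m) (s m n) (s n i)
    + eta_coef q i *: tens4 (s i k) (s k l) (s l m * s m n) (s n i)
    - eta_coef q i *: tens4 (s i k) (s k l) (s l m) (s m n * s n i)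
    + eta_coef q n *: tens4 (s n i * s i k) (s k l) (s l m) (s m n))).
  do 5!(rewrite (linp_sum bl); apply: eq_bigr => ? _).
  exact: bE.
rewrite sum5D sum5B sum5D sum5B trace_face0 trace_face1 trace_face2 trace_face3.
rewrite subrr addr0 subr0 add0r.
(* Only the last face remains; read from n, it is the trace of the first face. *)
by rewrite sum5_rot trace_face0.
Qed.

(** The twist conjugates the tensor power of the matrix by eta, hence fixes its diagonal entries. *)
Lemma omega4_twisted_chain : twisted_chain (twist act) (omega4 q).
Proof.
have kl : linear (twist act) by exact: al.
have ml := tensor_map_linear (n := 5) kl.
rewrite /twisted_chain omega4E (linp_sum ml); apply: eq_bigr => i _.
rewrite (linpZ ml) (tensor_map_chain (k := fun i : 'I_4 => eta_coef q i)) //.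
- by rewrite divff ?scale1r //; exact: eta_neq0.
- exact: eta_neq0.
- exact: twist_shift.
Qed.

Lemma coproduct_K i : coproduct (UK q i) = tpure [tuple UK q i; UK q i].
Proof. exact: (plift_gen (P := so5_presentation q) (coproduct_rel q0 qr) (GK i)). Qed.

Lemma coproduct_KV i : coproduct (UKV q i) = tpure [tuple UKV q i; UKV q i].
Proof. exact: (plift_gen (P := so5_presentation q) (coproduct_rel q0 qr) (GKV i)). Qed.

Lemma coproduct_E i : coproduct (UE q i) =
  tpure [tuple UE q i; UK q i] + tpure [tuple UKV q i; UE q i].
Proof. exact: (plift_gen (P := so5_presentation q) (coproduct_rel q0 qr) (GE i)). Qed.

Lemma coproduct_F i : coproduct (UF q i) =
  tpure [tuple UF q i; UK q i] + tpure [tuple UKV q i; UF q i].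
Proof.
by rewrite (coproduct_star q0 qr) coproduct_E starD !tpure2_star UK_star UKV_star.
Qed.

Lemma act_KV_shift r (i j : 'I_4) :
  act (UKV q r) (s i j) = (weight q r j / weight q r i) *: s i j.
Proof.
rewrite (act_KV (c := weight q r i / weight q r j) actP) ?act_K_shift ?invf_div //.
by rewrite mulf_neq0 ?invr_neq0 ?weight_neq0.
Qed.

Lemma omega4_invariant h : tensor_act act h (omega4 q) = counit h *: omega4 q.
Proof.
have w0 r (i : 'I_4) : weight q r i != 0 by exact: weight_neq0.
have tl g := tensor_act_linearr actP (n := 4) g.
move: h; apply: (tensor_act_invariant q0 qr actP) => r; rewrite omega4E.
- rewrite (linp_sum (tl _)); apply: eq_bigr => i _; rewrite (linpZ (tl _)).
  rewrite (tensor_act_chain_group q0 qr actP (k := fun i : 'I_4 => weight q r i)) //.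
  + by rewrite divff ?scale1r.
  + exact: coproduct_K.
  + exact: act_K_shift.
- rewrite (linp_sum (tl _)); apply: eq_bigr => i _; rewrite (linpZ (tl _)).
  (* The inverse of K_r conjugates by the inverse diagonal matrix. *)
  rewrite (tensor_act_chain_group q0 qr actP (k := fun i : 'I_4 => (weight q r i)^-1)) //.
  + by rewrite divff ?scale1r ?invr_eq0.
  + by move=> j; rewrite invr_eq0.
  + exact: coproduct_KV.
  + by move=> j l; rewrite act_KV_shift invrK mulrC.
- apply: (tensor_act_trace_skew q0 qr actP (k := fun i : 'I_4 => weight q r i) (w0 r)
    (g := UK q r) (g' := UKV q r) (c := q ^- r.+1) (eps := fun i j : 'I_4 => step q r i j)) => //.
  + exact: coproduct_K.
  + exact: coproduct_E.
  + exact: act_K_shift.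
  + exact: act_KV_shift.
  + exact: step_weight.
  + exact: act_E_shift.
  + exact: eta_step.
- have c0 : q ^+ r.+1 != 0 by rewrite expf_neq0.
  (* For a lowering operator the matrix [step] is transposed, which inverts the scalar in both
     commutation rules. *)
  apply: (tensor_act_trace_skew q0 qr actP (k := fun i : 'I_4 => weight q r i) (w0 r)
    (g := UK q r) (g' := UKV q r) (c := q ^+ r.+1) (eps := fun i j : 'I_4 => step q r j i)) => //.
  + exact: coproduct_K.
  + exact: coproduct_F.
  + exact: act_K_shift.
  + exact: act_KV_shift.
  + by move=> i j; rewrite [_ * weight q r j]mulrC step_weight // mulVKf // mulrC.
  + exact: act_F_shift.
  + move=> i j; rewrite [_ * eta_coef q j]mulrC eta_step // exprVn mulVKf ?expf_neq0 //.
    by rewrite mulrC.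
Qed.

End Sphere.

(** * Specialization to a real parameter between 0 and 1, over the complex numbers *)

Local Open Scope complex_scope.

Theorem proposition4p21 (R : realType) (q : R) (q_gt0 : 0 < q) (q_lt1 : q < 1)
  (act : Uso5 q%:C -> sphere4 q%:C -> sphere4 q%:C)
  (act_module : module_star_algebra act)
  (act_gens : sphere_action act) :
  [/\ forall h : Uso5 q%:C,
        tensor_act act h (omega4 q%:C) = counit h *: omega4 q%:C,
      twisted_chain (twist act) (omega4 q%:C)
    & twisted_boundary (twist act) (omega4 q%:C) = 0].
Proof.
have qC0 : 0 < q%:C by rewrite ltcR.
have qC1 : q%:C != 1 by rewrite lt_eqF // ltcR.
split.
- exact: omega4_invariant.
- exact: omega4_twisted_chain.
- exact: omega4_boundary.
Qed.
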